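(* Let $\mathcal{G}$ be an \'etale groupoid with the Fourier coefficients approximation property, let $\Gamma$ be a countable infinite nonabelian group with identity $e$, let $c:\mathcal{G}\to\Gamma$ be a continuous $1$-cocycle, and let $M$ be a diagonal bimodule of $C_r^*(\mathcal{G})$. Then the following statements hold. (i) If $M$ is $\delta_c$-invariant, then $M$ is spectral if and only if $M\cap C_r^*(\mathcal{G})_t$ is spectral for each $t\in\Gamma$. (ii) If $M$ is spectral, then $M$ is $\delta_c$-invariant. Moreover, when $c^{-1}(e)=\mathcal{G}^{(0)}$, the converse also holds; that is, $M$ is spectral if and only if $M$ is $\delta_c$-invariant.
   Context: An \'etale groupoid means a second countable, locally compact, Hausdorff topological groupoid $\mathcal{G}$ whose range and source maps $r,s:\mathcal{G}\to\mathcal{G}^{(0)}$ are local homeomorphisms; $\mathcal{G}^{(0)}$ is the unit space and $\mathcal{G}_u=s^{-1}(u)$. $C_c(\mathcal{G})$ is a $*$-algebra with $f^*(\gamma)=\overline{f(\gamma^{-1})}$ and $(fg)(\gamma)=\sum_{\gamma'\in\mathcal{G}_{s(\gamma)}}f(\gamma\gamma'^{-1})g(\gamma')$; $C_r^*(\mathcal{G})$ is its completion in the norm $\|f\|_{\mathrm{red}}=\sup_{u\in\mathcal{G}^{(0)}}\|\mathrm{Ind}_u(f)\|$, where $\mathrm{Ind}_u(f)\xi(\gamma)=\sum_{\gamma'\in\mathcal{G}_u}f(\gamma\gamma'^{-1})\xi(\gamma')$ on $\ell^2(\mathcal{G}_u)$. The inclusion $C_c(\mathcal{G})\subseteq C_0(\mathcal{G})$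 extends to a norm-decreasing injective linear map $j:C_r^*(\mathcal{G})\to C_0(\mathcal{G})$, and each $a\in C_r^*(\mathcal{G})$ is identified with the function $j(a)$; write $a(\gamma)=j(a)(\gamma)$ and $\mathrm{supp}'(a)=\{\gamma\in\mathcal{G}:a(\gamma)\neq0\}$. $C_0(\mathcal{G}^{(0)})$ is regarded as a $C^*$-subalgebra of $C_r^*(\mathcal{G})$. For open $P\subseteq\mathcal{G}$, $C_c(P)\subseteq C_c(\mathcal{G})$ via extension by zero. A diagonal bimodule of $C_r^*(\mathcal{G})$ is a norm closed subspace $M$ such that $ab,ba\in M$ for all $a\in M$, $b\in C_0(\mathcal{G}^{(0)})$. Its spectrum is $\sigma(M)=\{\gamma\in\mathcal{G}:a(\gamma)\ne0\text{ for some }a\in M\}$. For open $P\subseteq\mathcal{G}$, $A(P)=\{a\in C_r^*(\mathcal{G}):a(\gamma)=0\text{ for all }\gamma\notin P\}$ (so $A(\emptyset)=\{0\}$). $M$ is spectral if $M=A(\sigma(M))$. $\mathcal{G}$ has the Fourier coefficients approximation property if $a\in\overline{C_c(\mathrm{supp}'(a))}$ (closure in the reduced norm) for all $a\in C_r^*(\mathcal{G})$. A continuous $1$-cocycle is a continuous groupoid homomorphism $c:\mathcal{G}\to\Gamma$ ($\Gamma$ discrete). Let $\lambda$ be the left regular representation of $\Gamma$ on $\ell^2(\Gamma)$. The cocycle induces a coaction $\delta_c:C_r^*(\mathcal{G})\to C_r^*(\mathcal{G})\otimes_{\min}C_r^*(\Gamma)$, the nondegenerate $*$-homomorphism determined by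 $\delta_c(f)=f\otimes\lambda_t$ for $f\in C_c(\mathcal{G})$ with $\mathrm{supp}(f)\subseteq c^{-1}(t)$, $t\in\Gamma$. The spectral subspaces are $C_r^*(\mathcal{G})_t=\{a\in C_r^*(\mathcal{G}):\delta_c(a)=a\otimes\lambda_t\}$. A closed subspace $M$ is $\delta_c$-invariant if $\delta_c(M)\subseteq M\otimes_{\min}C_r^*(\Gamma)$, where $M\otimes_{\min}C_r^*(\Gamma)=\overline{\mathrm{span}}\{a\otimes b: a\in M,b\in C_r^*(\Gamma)\}$. *)

(* Defs.v *)
From HB Require Import structures.
From mathcomp Require Import all_boot all_order all_algebra complex.
From mathcomp Require Import all_classical all_reals all_analysis.
From mathcomp Require Import ring lra.
Import numFieldNormedType.Exports.

Set Implicit Arguments.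
Unset Strict Implicit.
Unset Printing Implicit Defensive.

Import Order.TTheory GRing.Theory Num.Theory.

Local Open Scope classical_set_scope.
Local Open Scope complex_scope.
Local Open Scope ring_scope.

(* The regular module R[i]^o carries the usual topology of the complex
   numbers; R[i] itself has no topology in the library. *)
Notation Cplx R := (R[i]^o).

Definition abs2 (R : realType) (z : R[i]) : R :=
  complex.Re z ^+ 2 + complex.Im z ^+ 2.

Definition l2sum (R : realType) (X : choiceType) (f : X -> Cplx R) : \bar R :=
  \esum_(x in [set: X]) (abs2 (f x))%:E.

Record l2 (R : realType) (X : choiceType) := L2 {
  l2fun :> X -> Cplx R;
  l2P : (l2sum l2fun < +oo)%E }.

HB.instance Definition _ R X := gen_eqMixin (l2 R X).
HB.instance Definition _ R X := gen_choiceMixin (l2 R X).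

Section l2_module.
Variables (R : realType) (X : choiceType).
Implicit Types (f g : X -> Cplx R) (xi eta : l2 R X).

Lemma l2_eq xi eta : (forall x, xi x = eta x) -> xi = eta.
Proof.
case: xi eta => [f fP] [g gP] /= fg; have E : f = g by apply/funext.
by case: _ / E gP => gP; congr L2; exact: Prop_irrelevance.
Qed.

Lemma abs2_ge0 (z : R[i]) : 0 <= abs2 z.
Proof. by rewrite addr_ge0// sqr_ge0. Qed.

Lemma abs2M (z w : R[i]) : abs2 (z * w) = abs2 z * abs2 w.
Proof. by case: z w => [a b] [c d]; rewrite /abs2 /=; ring. Qed.

Lemma abs2D (z w : R[i]) : abs2 (z + w) <= 2 * abs2 z + 2 * abs2 w.
Proof.
case: z w => [a b] [c d]; rewrite /abs2 /= -subr_ge0.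
suff -> : 2 * (a ^+ 2 + b ^+ 2) + 2 * (c ^+ 2 + d ^+ 2) -
    ((a + c) ^+ 2 + (b + d) ^+ 2) = (a - c) ^+ 2 + (b - d) ^+ 2.
  by rewrite addr_ge0// sqr_ge0.
ring.
Qed.

Lemma esumZ_le (Y : choiceType) (c : R) (a : Y -> R) :
  0 <= c -> (forall x, 0 <= a x) ->
  (\esum_(x in [set: Y]) (c * a x)%:E
   <= c%:E * \esum_(x in [set: Y]) (a x)%:E)%E.
Proof.
move=> c0 a0; apply: ge_ereal_sup => _ [A [finA _] <-].
under eq_fsbigr do rewrite EFinM.
rewrite -ge0_mule_fsumr; last by move=> x; rewrite lee_fin.
apply: lee_wpmul2l; rewrite ?lee_fin//.
by apply: ereal_sup_ubound; exists A.
Qed.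

Lemma l2sum_ge0 f : (0 <= l2sum f)%E.
Proof. by apply: esum_ge0 => x _; rewrite lee_fin abs2_ge0. Qed.

Lemma l2sum_fin xi : l2sum xi \is a fin_num.
Proof. by rewrite ge0_fin_numE ?l2sum_ge0// l2P. Qed.

Lemma l2sumZ (k : R[i]) f : (l2sum f < +oo)%E ->
  (l2sum (fun x => (k * f x)%R) < +oo)%E.
Proof.
move=> fP; apply: (@le_lt_trans _ _ ((abs2 k)%:E * l2sum f)%E).
  rewrite /l2sum; under eq_esum do rewrite abs2M.
  by apply: esumZ_le => *; exact: abs2_ge0.
rewrite lte_mul_pinfty ?lee_fin ?abs2_ge0//.
Qed.

Lemma l2sumD f g : (l2sum f < +oo)%E -> (l2sum g < +oo)%E ->
  (l2sum (fun x => (f x + g x)%R) < +oo)%E.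
Proof.
move=> fP gP.
apply: (@le_lt_trans _ _ (2%:E * l2sum f + 2%:E * l2sum g)%E); last first.
  by rewrite lte_add_pinfty// lte_mul_pinfty.
apply: (@le_trans _ _ (\esum_(x in [set: X])
    ((2 * abs2 (f x))%:E + (2 * abs2 (g x))%:E))%E).
  by apply: le_esum => x _; rewrite -EFinD lee_fin abs2D.
rewrite esumD; try by move=> x _; rewrite lee_fin mulr_ge0 ?abs2_ge0.
by apply: leeD; apply: esumZ_le => *; rewrite ?abs2_ge0.
Qed.

Lemma l2sum0 : (l2sum (fun _ : X => 0%R : Cplx R) < +oo)%E.
Proof.
by rewrite /l2sum esum1// => x _; rewrite /abs2 /= expr0n addr0.
Qed.

Definition l2_zero := L2 l2sum0.
Definition l2_scale (k : R[i]) xi := L2 (l2sumZ k (l2P xi)).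
Definition l2_add xi eta := L2 (l2sumD (l2P xi) (l2P eta)).
Definition l2_opp xi := l2_scale (-1) xi.

Let addA : associative l2_add.
Proof. by move=> *; apply: l2_eq => x /=; rewrite addrA. Qed.
Let addC : commutative l2_add.
Proof. by move=> *; apply: l2_eq => x /=; rewrite addrC. Qed.
Let add0 : left_id l2_zero l2_add.
Proof. by move=> *; apply: l2_eq => x /=; rewrite add0r. Qed.
Let addN : left_inverse l2_zero l2_opp l2_add.
Proof. by move=> *; apply: l2_eq => x /=; rewrite mulN1r addNr. Qed.

HB.instance Definition _ := GRing.isZmodule.Build (l2 R X) addA addC add0 addN.

Let scaleA (a b : R[i]) xi : l2_scale a (l2_scale b xi) = l2_scale (a * b) xi.
Proof. by apply: l2_eq => x /=; rewrite mulrA. Qed.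
Let scale1 : left_id 1 l2_scale.
Proof. by move=> *; apply: l2_eq => x /=; rewrite mul1r. Qed.
Let scaleDr : right_distributive l2_scale +%R.
Proof. by move=> *; apply: l2_eq => x /=; rewrite mulrDr. Qed.
Let scaleDl xi : {morph l2_scale^~ xi : a b / a + b}.
Proof. by move=> *; apply: l2_eq => x /=; rewrite mulrDl. Qed.

HB.instance Definition _ :=
  GRing.Zmodule_isLmodule.Build R[i] (l2 R X) scaleA scale1 scaleDr scaleDl.

Definition l2norm xi : R := Num.sqrt (fine (l2sum xi)).

(* The sum of an absolutely summable real family. *)
Definition rsum (u : X -> R) : R :=
  fine (\esum_(x in [set: X]) (Num.max (u x) 0)%:E) -
  fine (\esum_(x in [set: X]) (Num.max (- u x) 0)%:E).

Definition l2inner xi eta : R[i] :=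
  rsum (fun x => complex.Re (xi x * (eta x)^*)) +i*
  rsum (fun x => complex.Im (xi x * (eta x)^*)).

Lemma l2sum_delta (x : X) : l2sum (fun y => (y == x)%:R : Cplx R) = 1%E.
Proof.
rewrite /l2sum (esumID [set x]); last by move=> *; rewrite lee_fin abs2_ge0.
rewrite setTI [X in (X + _)%E](_ : _ = 1%E); last first.
  rewrite esum_set1 ?lee_fin ?abs2_ge0// eqxx /abs2 /=.
  by rewrite expr1n expr0n addr0.
rewrite [X in (_ + X)%E]esum1 ?adde0// => y [_ /= /eqP/negbTE ->].
by rewrite /abs2 /= expr0n addr0.
Qed.

Lemma l2delta_subproof (x : X) :
  (l2sum (fun y => (y == x)%:R%R : Cplx R) < +oo)%E.
Proof. by rewrite l2sum_delta ltry. Qed.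

Definition l2delta (x : X) : l2 R X := L2 (l2delta_subproof x).

End l2_module.

Lemma l2tensor_subproof (R : realType) (X Y : choiceType)
    (xi : l2 R X) (eta : l2 R Y) :
  (l2sum (fun p : X * Y => (xi p.1 * eta p.2)%R : Cplx R) < +oo)%E.
Proof.
pose N := fine (l2sum eta).
have NE : (N%:E = l2sum eta)%E by rewrite fineK// l2sum_fin.
have N0 : 0 <= N by rewrite fine_ge0 ?l2sum_ge0.
rewrite /l2sum.
rewrite (_ : [set: X * Y] = [set: X] `*`` (fun=> [set: Y])); last first.
  by apply/seteqP; split.
rewrite -(@esum_esum _ _ _ _ _ (fun x y => (abs2 (xi x * eta y))%:E)); last first.
  by move=> *; rewrite lee_fin abs2_ge0.
apply: (@le_lt_trans _ _ (N%:E * l2sum xi)%E); last first.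
  by apply: lte_mul_pinfty => //; exact: l2P.
apply: (@le_trans _ _ (\esum_(x in [set: X]) (N * abs2 (xi x))%:E)).
  apply: le_esum => x _; under eq_esum do rewrite abs2M.
  rewrite mulrC EFinM NE; apply: esumZ_le => *; exact: abs2_ge0.
by apply: esumZ_le => // *; exact: abs2_ge0.
Qed.

Definition l2tensor (R : realType) (X Y : choiceType)
    (xi : l2 R X) (eta : l2 R Y) : l2 R (X * Y)%type :=
  L2 (l2tensor_subproof xi eta).

Notation l2op R X := (l2 R X -> l2 R X).

Section operators.
Variables (R : realType) (X : choiceType).
Implicit Types (T : l2op R X) (V : set (l2op R X)).

Definition norm_le T (k : R) := forall xi, l2norm (T xi) <= k * l2norm xi.

Definition bounded_op T :=
  (forall (k : R[i]) xi eta, T (k *: xi + eta) = k *: T xi + T eta) /\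
  exists k, norm_le T k.

Definition is_adjoint T T' :=
  forall xi eta, l2inner (T xi) eta = l2inner xi (T' eta).

Definition subspace V :=
  V 0 /\ forall (k : R[i]) S T, V S -> V T -> V (k *: S + T).

Definition lspan V : set (l2op R X) :=
  [set T | forall W, subspace W -> V `<=` W -> W T].

Definition opclosure V : set (l2op R X) :=
  [set T | bounded_op T /\
    forall e : R, 0 < e -> exists2 S, V S & norm_le (T - S) e].

Definition closed_subspace V := subspace V /\ opclosure V `<=` V.

End operators.

Definition is_tensor (R : realType) (X Y : choiceType)
    (S : l2op R X) (T : l2op R Y) (U : l2op R (X * Y)%type) :=
  bounded_op U /\
  forall xi eta, U (l2tensor xi eta) = l2tensor (S xi) (T eta).

(* For V and W among the operators on l^2(X) and l^2(Y), the closed span of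
   the elementary tensors inside the operators on l^2(X * Y). *)
Definition min_tensor (R : realType) (X Y : choiceType)
    (V : set (l2op R X)) (W : set (l2op R Y)) : set (l2op R (X * Y)%type) :=
  opclosure (lspan [set U | exists S T, [/\ V S, W T & is_tensor S T U]]).

Lemma lambda_subproof (R : realType) (Gamma : groupType) (t : Gamma)
    (eta : l2 R Gamma) :
  (l2sum (fun x => eta (t^-1 * x)%g) < +oo)%E.
Proof.
rewrite /l2sum.
rewrite -(@reindex_esum R Gamma Gamma setT setT (fun x => (t^-1 * x)%g)
  (fun y => (abs2 (eta y))%:E)); last first.
  by split=> // [x y _ _ /mulgI//|y _]; exists (t * y)%g => //; rewrite mulKg.
exact: l2P.
Qed.

Definition lambda (R : realType) (Gamma : groupType) (t : Gamma)
    : l2op R Gamma := fun eta => L2 (lambda_subproof t eta).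

Definition Crg (R : realType) (Gamma : groupType) : set (l2op R Gamma) :=
  opclosure (lspan (range (@lambda R Gamma))).

Arguments lambda R {Gamma} t.
Arguments Crg R Gamma : clear implicits.

(* The multiplication is a total function, whose value only matters on
   composable pairs. *)
Record groupoid (G : Type) := Groupoid {
  src : G -> G;
  rng : G -> G;
  gmul : G -> G -> G;
  ginv : G -> G;
  src_gmul : forall x y, src x = rng y -> src (gmul x y) = src y;
  rng_gmul : forall x y, src x = rng y -> rng (gmul x y) = rng x;
  gmulA : forall x y z, src x = rng y -> src y = rng z ->
    gmul x (gmul y z) = gmul (gmul x y) z;
  src_ginv : forall x, src (ginv x) = rng x;
  rng_ginv : forall x, rng (ginv x) = src x;
  gmulV : forall x, gmul x (ginv x) = rng x;
  gVmul : forall x, gmul (ginv x) x = src x;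
  gmul_src : forall x, gmul x (src x) = x;
  rng_mulg : forall x, gmul (rng x) x = x }.

Section etale.
Variables (G : topologicalType) (Gr : groupoid G).

Definition units : set G := range (src Gr).

Definition composable : set (G * G) := [set p | src Gr p.1 = rng Gr p.2].

(* f is a local homeomorphism onto its codomain Y, for the subspace topology
   of Y. *)
Definition local_homeomorphism (f : G -> G) (Y : set G) :=
  (forall x, Y (f x)) /\
  forall x, exists (U : set G) (g : G -> G),
    [/\ open U /\ U x,
        exists2 W, open W & f @` U = W `&` Y,
        {within U, continuous f},
        {within f @` U, continuous g} &
        forall y, U y -> g (f y) = y].

Definition etale_groupoid :=
  [/\ @second_countable G, locally_compact [set: G] & hausdorff_space G] /\
  [/\ {within composable, continuous (fun p => gmul Gr p.1 p.2)},
      continuous (ginv Gr),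
      local_homeomorphism (rng Gr) units &
      local_homeomorphism (src Gr) units].

Definition cocycle (Gamma : groupType) (c : G -> Gamma) :=
  (forall x y, src Gr x = rng Gr y -> c (gmul Gr x y) = (c x * c y)%g) /\
  forall A : set Gamma, open (c @^-1` A).

End etale.

Section reduced_algebra.
Variables (R : realType) (G : topologicalType) (Gr : groupoid G).
Implicit Types (f : G -> Cplx R) (a b T : l2op R G) (P : set G).

Definition supp f : set G := closure [set x | f x != 0].

Definition Cc P f := [/\ continuous f, compact (supp f) & supp f `<=` P].

Definition C0_units f :=
  [/\ continuous f, forall x, ~ units Gr x -> f x = 0 &
      forall e : R, 0 < e -> compact [set x | e%:C <= `|f x|]].

(* T is the operator of left convolution by f on l^2(G), which is the direct
   sum of the l^2(G_u), so that T is the direct sum of the Ind_u(f).  The sum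
   has finitely many nonzero terms when f is in C_c(G) or in C_0(G^(0)). *)
Definition is_conv f T := forall (xi : l2 R G) x,
  T xi x = \sum_(y \in [set y | src Gr y = src Gr x])
             f (gmul Gr x (ginv Gr y)) * xi y.

Definition Cc_op P : set (l2op R G) := [set T | exists2 f, Cc P f & is_conv f T].

Definition C0_units_op : set (l2op R G) :=
  [set T | exists2 f, C0_units f & is_conv f T].

(* The operator norm of the direct sum of the Ind_u(f) is the supremum of
   their norms, so this closure is the completion for the reduced norm. *)
Definition Cr : set (l2op R G) := opclosure (Cc_op [set: G]).

Definition jmap a : G -> Cplx R := fun x => a (l2delta R (src Gr x)) x.

(* jmap is linear; the next two lemmas show that it extends the inclusion of
   C_c(G) and is norm-decreasing. *)
Lemma jmap_conv f T : is_conv f T -> jmap T = f.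
Proof.
move=> fT; apply/funext => x; rewrite /jmap fT.
have srcK y : src Gr (src Gr y) = src Gr y.
  by rewrite -[X in src Gr X](gVmul Gr y) src_gmul// src_ginv.
have rngK y : rng Gr (src Gr y) = src Gr y.
  by rewrite -[X in rng Gr X](gVmul Gr y) rng_gmul ?src_ginv// rng_ginv.
have invs y : ginv Gr (src Gr y) = src Gr y.
  by have := gVmul Gr (src Gr y); rewrite -{2}(rngK y) -src_ginv gmul_src srcK.
rewrite -(@fsbig_widen _ _ _ _ [set src Gr x]).
- by rewrite fsbig_set1/= eqxx mulr1 invs gmul_src.
- by move=> y ->; exact: srcK.
- by move=> y [_ /= /eqP/negbTE ->]; rewrite mulr0.
Qed.

Lemma jmap_le a (k : R) x : norm_le a k -> `|jmap a x| <= k%:C.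
Proof.
move=> /(_ (l2delta R (src Gr x))); set xi := a _ => xik.
have k1 : l2norm xi <= k.
  by move: xik; rewrite /l2norm l2sum_delta sqrtr1 mulr1.
rewrite normc_def lecR; apply: le_trans k1; apply: ler_wsqrtr.
rewrite -lee_fin fineK ?l2sum_fin//.
apply: ereal_sup_ubound; exists [set x]; first by split.
by rewrite fsbig_set1.
Qed.

Definition supp' a : set G := [set x | jmap a x != 0].

Definition FCAP := forall a, Cr a -> opclosure (Cc_op (supp' a)) a.

Definition diagonal_bimodule (M : set (l2op R G)) :=
  [/\ closed_subspace M, M `<=` Cr &
      forall a b, M a -> C0_units_op b -> M (a \o b) /\ M (b \o a)].

Definition spectrum (M : set (l2op R G)) : set G :=
  [set x | exists2 a, M a & jmap a x != 0].

Definition Asub P : set (l2op R G) :=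
  [set a | Cr a /\ forall x, ~ P x -> jmap a x = 0].

Definition spectral (M : set (l2op R G)) := M = Asub (spectrum M).

End reduced_algebra.

Arguments Cr R {G} Gr.
Arguments FCAP R {G} Gr.
Arguments C0_units_op R {G} Gr.
Arguments Cc_op R {G} Gr P.

Section coaction.
Variables (R : realType) (G : topologicalType) (Gr : groupoid G).
Variables (Gamma : groupType) (c : G -> Gamma).
Variable delta : l2op R G -> l2op R (G * Gamma)%type.

Definition star_hom (A : set (l2op R G)) (B : set (l2op R (G * Gamma)%type)) :=
  [/\ forall a, A a -> B (delta a),
      forall (k : R[i]) a b, A a -> A b ->
        delta (k *: a + b) = k *: delta a + delta b,
      forall a b, A a -> A b -> delta (a \o b) = delta a \o delta b &
      forall a b, A a -> A b -> is_adjoint a b ->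
        is_adjoint (delta a) (delta b)].

Definition nondegenerate (A : set (l2op R G))
    (B : set (l2op R (G * Gamma)%type)) :=
  B `<=` opclosure (lspan [set U | exists a b, [/\ A a, B b & U = delta a \o b]]).

(* A *-homomorphism is automatically contractive, so the last clause determines
   delta on C*_r(G); its values outside C*_r(G) are irrelevant. *)
Definition induced_coaction :=
  let A := Cr R Gr in let B := min_tensor A (Crg R Gamma) in
  [/\ star_hom A B, nondegenerate A B &
      forall t f F, Cc [set: G] f -> supp f `<=` c @^-1` [set t] ->
        is_conv Gr f F -> is_tensor F (lambda R t) (delta F)].

Definition spectral_subspace (t : Gamma) : set (l2op R G) :=
  [set a | Cr R Gr a /\ is_tensor a (lambda R t) (delta a)].

Definition coaction_invariant (M : set (l2op R G)) :=
  forall a, M a -> min_tensor M (Crg R Gamma) (delta a).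

End coaction.

(* Main.v *)
Require Import Defs.
From mathcomp Require Import all_boot all_order all_algebra complex.
From mathcomp Require Import all_classical all_reals all_analysis.
From mathcomp Require Import ring lra.
Import numFieldNormedType.Exports.

(** Let C be the reduced algebra and E_t(a) the component of a of degree t in
    Gamma, which as a function on the groupoid is a restricted to c^-1(t).
    Everything rests on two descriptions of E_t.

    On a convolution operator F, with compactly supported f, the function f
    meets finitely many of the open and closed sets c^-1(t), and F is the finite
    sum of its components F_t, with delta(F) the sum of the F_t (x) lambda_t
    ([homogeneous_decomposition], [coaction_component]). The operator F_t is
    bounded because it is obtained from F by compressions to the mutually
    orthogonal subspaces l^2(c^-1(u)) ([component_exists]).

    On the whole of C, the component E_t(a) is the slice of delta(a) by the
    functional b |-> < b delta_1, delta_t > ([jmap_slice]). This is clear on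
    convolution operators, and extends to limits because delta is continuous.
    Continuity is a theorem about star-homomorphisms: if a is small, then
    1 - a* a is the square of a self-adjoint element 1 - k with k in C, where k
    is a limit of polynomials in a* a; applying delta shows that
    1 - delta(a)* delta(a) is the square of a self-adjoint operator, so that
    delta(a) is a contraction ([square_root_exists], [star_hom_contract]). The
    argument needs C to be complete and closed under products and adjoints,
    hence the convolution of two compactly supported continuous functions to be
    continuous; this is a property of sums over the fibres of the local
    homeomorphism s ([fibre_sum_continuous], [Cr_mul], [Cr_adjoint]).

    With the approximation property, a in A(sigma(M)) is a limit of convolution
    operators F supported in sigma(M). Their components F_t are supported in
    sigma(M) as well, so if M is spectral they belong to M, and delta(a), the
    limit of the sums of the F_t (x) lambda_t, lies in the tensor product of M
    with the algebra of Gamma: M is invariant ([spectral_invariant]). Conversely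
    let M be invariant. Slicing shows that E_t maps M to M, so every point of
    sigma(M) of degree t is in the spectrum of the part of M of degree t
    ([invariant_component]), and M is spectral as soon as it contains the
    convolution operators supported in sigma(M) and in a single c^-1(t)
    ([spectral_of_homogeneous]). This is the case when the homogeneous parts of
    M are spectral, which is the first statement. It is also the case when
    c^-1(1) is the unit space: then s is injective on c^-1(t), and a function f
    with compact support in sigma(M) and in c^-1(t) is a finite sum of products
    of homogeneous elements of M by functions on the unit space
    ([bisection_conv_mem]). *)

Set Implicit Arguments.
Unset Strict Implicit.
Unset Printing Implicit Defensive.

Import Order.TTheory GRing.Theory Num.Theory.

Local Open Scope classical_set_scope.
Local Open Scope complex_scope.
Local Open Scope ring_scope.

(* Linear subspaces, as opposed to the subspace topology of the same name. *)
Local Notation subspace := Defs.subspace.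

(** * Sums of summable families *)

Section summation.
Variables (R : realType) (X : choiceType).
Implicit Types (u v : X -> R).

Local Notation esumT u := (\esum_(x in [set: X]) (u x)%:E)%E.

Lemma esumT_ge0 u : (forall x, 0 <= u x) -> (0 <= esumT u)%E.
Proof. by move=> u0; apply: esum_ge0 => x _; rewrite lee_fin. Qed.

Lemma esumT_fin u : (forall x, 0 <= u x) -> (esumT u < +oo)%E ->
  esumT u \is a fin_num.
Proof. by move=> u0 uoo; rewrite ge0_fin_numE ?esumT_ge0. Qed.

Lemma esumT_lt u v : (forall x, u x <= v x) -> (esumT v < +oo)%E ->
  (esumT u < +oo)%E.
Proof. by move=> uv; apply: le_lt_trans; apply: le_esum => x _; rewrite lee_fin. Qed.

Lemma esumT_ltD u v : (forall x, 0 <= u x) -> (forall x, 0 <= v x) ->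
  (esumT u < +oo)%E -> (esumT v < +oo)%E -> (esumT (fun x => u x + v x)%R < +oo)%E.
Proof.
move=> u0 v0 uoo voo; under eq_esum do rewrite EFinD.
by rewrite esumD ?lte_add_pinfty// => x _; rewrite lee_fin.
Qed.

Lemma fine_esumD u v : (forall x, 0 <= u x) -> (forall x, 0 <= v x) ->
  (esumT u < +oo)%E -> (esumT v < +oo)%E ->
  fine (esumT (fun x => u x + v x)%R) = fine (esumT u) + fine (esumT v).
Proof.
move=> u0 v0 uoo voo; under eq_esum do rewrite EFinD.
by rewrite esumD ?fineD ?esumT_fin// => x _; rewrite lee_fin.
Qed.

Lemma esumTZ (k : R) u : 0 <= k -> (forall x, 0 <= u x) ->
  esumT (fun x => k * u x)%R = (k%:E * esumT u)%E.
Proof.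
rewrite le_eqVlt => /predU1P[<-|k0] u0.
  by rewrite mul0e esum1// => x _; rewrite mul0r.
apply/eqP; rewrite eq_le esumZ_le ?(ltW k0)//=.
have := @esumZ_le R X k^-1 (fun x => k * u x).
rewrite invr_ge0 (ltW k0) => /(_ isT (fun x => mulr_ge0 (ltW k0) (u0 x))).
under eq_esum do rewrite mulrA mulVf ?gt_eqF// mul1r.
by move=> h; rewrite muleC -lee_pdivlMr// muleC.
Qed.

(** Any splitting of a summable family as a difference of nonnegative ones
    computes its sum; the additivity of [rsum] follows from this freedom. *)
Lemma rsumB u v : (forall x, 0 <= u x) -> (forall x, 0 <= v x) ->
  (esumT u < +oo)%E -> (esumT v < +oo)%E ->
  rsum (fun x => u x - v x) = fine (esumT u) - fine (esumT v).
Proof.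
move=> u0 v0 uoo voo; rewrite /rsum.
set p := esumT (fun x => Num.max (u x - v x) 0).
set n := esumT (fun x => Num.max (- (u x - v x)) 0).
have p0 x : 0 <= Num.max (u x - v x) 0 by rewrite le_max lexx orbT.
have n0 x : 0 <= Num.max (- (u x - v x)) 0 by rewrite le_max lexx orbT.
have poo : (p < +oo)%E.
  by apply: esumT_lt uoo => x; rewrite /= ge_max u0 lerBlDr lerDl v0.
have noo : (n < +oo)%E.
  by apply: esumT_lt voo => x; rewrite /= ge_max v0 opprB lerBlDr lerDl u0.
suff : fine p + fine (esumT v) = fine n + fine (esumT u) by lra.
rewrite -!fine_esumD//; congr fine; apply: eq_esum => x _; congr EFin.
by rewrite !maxEle; case: ifPn; case: ifPn; rewrite -?ltNge => ? ?; lra.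
Qed.

Definition abs_summable u := (esumT (fun x => `|u x|)%R < +oo)%E.

Lemma rsumE u : abs_summable u -> exists p n : X -> R,
  [/\ forall x, 0 <= p x /\ 0 <= n x, (esumT p < +oo)%E /\ (esumT n < +oo)%E &
      forall x, u x = p x - n x].
Proof.
move=> uoo; exists (fun x => Num.max (u x) 0), (fun x => Num.max (- u x) 0).
split=> [x|| x]; rewrite ?le_max ?lexx ?orbT//.
- by split; apply: esumT_lt uoo => x;
    rewrite /= ge_max normr_ge0 andbT ?(ler_norm (u x))// -normrN ler_norm.
- by rewrite !maxEle; case: ifPn; case: ifPn; rewrite -?ltNge => ? ?; lra.
Qed.

Lemma rsumD u v : abs_summable u -> abs_summable v ->
  rsum (fun x => u x + v x) = rsum u + rsum v.
Proof.
move=> /rsumE[p [n [pn0 [poo noo] un]]] /rsumE[q [m [qm0 [qoo moo] vm]]].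
have [p0 n0] := (fun x => (pn0 x).1, fun x => (pn0 x).2).
have [q0 m0] := (fun x => (qm0 x).1, fun x => (qm0 x).2).
have -> : u = fun x => p x - n x by apply/funext.
have -> : v = fun x => q x - m x by apply/funext.
rewrite (rsumB p0 n0)// (rsumB q0 m0)//.
have -> : (fun x => p x - n x + (q x - m x)) =
    (fun x => (p x + q x) - (n x + m x)) by apply/funext => x; lra.
rewrite (@rsumB (fun x => p x + q x) (fun x => n x + m x)).
- by rewrite (fine_esumD p0 q0)// (fine_esumD n0 m0)// opprD addrACA.
- by move=> x; rewrite addr_ge0.
- by move=> x; rewrite addr_ge0.
- exact: esumT_ltD.
- exact: esumT_ltD.
Qed.

Lemma rsumN u : rsum (fun x => - u x) = - rsum u.
Proof.
rewrite /rsum opprB; congr (_ - _); congr fine; apply: eq_esum => x _ //.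
by rewrite opprK.
Qed.

Lemma rsumZ_ge0 (k : R) u : 0 <= k -> rsum (fun x => k * u x) = k * rsum u.
Proof.
move=> k0; have mk0 (y : R) : Num.max (k * y) 0 = k * Num.max y 0.
  by rewrite -[in LHS](mulr0 k) maxr_pMr.
have fineZ (w : \bar R) : fine (k%:E * w)%E = k * fine w \/ ~ w \is a fin_num.
  by case: w => [r| |]; [left|right|right].
rewrite /rsum mulrBr; congr (_ - _).
  under eq_esum do rewrite mk0.
  rewrite esumTZ// => [|x]; last by rewrite le_max lexx orbT.
  case: (\esum_(_ in _) _)%E => [r| |] //=.
  - by rewrite mulr0; move: k0; rewrite le_eqVlt => /predU1P[<-|k0];
      rewrite ?mul0e// gt0_muley ?lte_fin.
  - by rewrite mulr0; move: k0; rewrite le_eqVlt => /predU1P[<-|k0];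
      rewrite ?mul0e// gt0_muleNy ?lte_fin.
under eq_esum do rewrite -mulrN mk0.
rewrite esumTZ// => [|x]; last by rewrite le_max lexx orbT.
case: (\esum_(_ in _) _)%E => [r| |] //=.
- by rewrite mulr0; move: k0; rewrite le_eqVlt => /predU1P[<-|k0];
    rewrite ?mul0e// gt0_muley ?lte_fin.
- by rewrite mulr0; move: k0; rewrite le_eqVlt => /predU1P[<-|k0];
    rewrite ?mul0e// gt0_muleNy ?lte_fin.
Qed.

Lemma rsumZ (k : R) u : rsum (fun x => k * u x) = k * rsum u.
Proof.
case: (leP 0 k) => [k0|k0]; first exact: rsumZ_ge0.
rewrite (_ : (fun x => k * u x) = (fun x => - (- k * u x))); last first.
  by apply/funext => x; rewrite mulNr opprK.
by rewrite rsumN rsumZ_ge0 ?oppr_ge0 ?(ltW k0)// mulNr opprK.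
Qed.

Lemma rsum_single (u : X -> R) x : (forall y, y != x -> u y = 0) -> rsum u = u x.
Proof.
move=> u0; have E (v : X -> R) : (forall y, y != x -> v y = 0) -> 0 <= v x ->
    fine (esumT v) = v x.
  move=> v0 vx; rewrite (esumID [set x]) => [|y _]; last first.
    by rewrite lee_fin; have [->//|/v0->] := eqVneq y x.
  rewrite setTI esum_set1 ?lee_fin// [X in (_ + X)%E]esum1 ?adde0//.
  by move=> y [_ /= /eqP/v0->].
rewrite /rsum !E ?le_max ?lexx ?orbT//.
- by rewrite !maxEle; case: ifPn; case: ifPn; rewrite -?ltNge => ? ?; lra.
- by move=> y /u0->; rewrite oppr0 maxxx.
- by move=> y /u0->; rewrite maxxx.
Qed.

Lemma esumT_le_seq u (M : R) : (forall x, 0 <= u x) ->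
  (forall s : seq X, uniq s -> \sum_(x <- s) u x <= M) -> (esumT u <= M%:E)%E.
Proof.
move=> u0 uM; apply: ge_ereal_sup => _ [A [finA _] <-].
by rewrite fsbig_finite//= sumEFin lee_fin uM// finmap.fset_uniq.
Qed.

Lemma seq_le_esumT u (s : seq X) : (forall x, 0 <= u x) -> uniq s ->
  ((\sum_(x <- s) u x)%:E <= esumT u)%E.
Proof.
move=> u0 us; apply: ereal_sup_ubound; exists [set` s]; first by split.
by rewrite -fsbig_seq// sumEFin.
Qed.

Lemma esumT_approx u (e : R) : (forall x, 0 <= u x) -> (esumT u < +oo)%E ->
  0 < e -> exists2 s : seq X, uniq s & fine (esumT u) - e < \sum_(x <- s) u x.
Proof.
move=> u0 uoo e0; have uf := esumT_fin u0 uoo.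
have [_ [A [finA _] <-]] := ub_ereal_sup_adherent e0 uf.
rewrite fsbig_finite//= -/(esum _ _) -(fineK uf) sumEFin -EFinB lte_fin.
by exists (finmap.enum_fset (fset_set A)) => //; exact: finmap.fset_uniq.
Qed.

End summation.

(** * The Hilbert space of square summable functions *)

Section hilbert.
Variables (R : realType) (X : choiceType).
Implicit Types (xi eta zeta : l2 R X) (k : R[i]).

Lemma l2addE xi eta x : (xi + eta) x = xi x + eta x.
Proof. by []. Qed.

Lemma l2scaleE k xi x : (k *: xi) x = k * xi x.
Proof. by []. Qed.

Lemma l2oppE xi x : (- xi) x = - xi x.
Proof. by rewrite /= mulN1r. Qed.

Lemma l2subE xi eta x : (xi - eta) x = xi x - eta x.
Proof. by rewrite l2addE l2oppE. Qed.

Lemma l2zeroE x : (0 : l2 R X) x = 0.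
Proof. by []. Qed.

Lemma l2bigE (I : Type) (s : seq I) (F : I -> l2 R X) x :
  (\sum_(i <- s) F i) x = \sum_(i <- s) F i x.
Proof.
elim: s => [|i s IH]; first by rewrite !big_nil.
by rewrite !big_cons l2addE IH.
Qed.

Lemma abs2N (z : R[i]) : abs2 (- z) = abs2 z.
Proof. by case: z => a b; rewrite /abs2 /= !sqrrN. Qed.

Lemma abs2_conj (z : R[i]) : abs2 z^* = abs2 z.
Proof. by case: z => a b; rewrite /abs2 /= sqrrN. Qed.

Lemma abs2_0 : abs2 (0 : R[i]) = 0.
Proof. by rewrite /abs2 /= expr0n addr0. Qed.

Lemma abs2_1 : abs2 (1 : R[i]) = 1.
Proof. by rewrite /abs2 /= expr0n expr1n addr0. Qed.

Lemma abs2_eq0 (z : R[i]) : abs2 z = 0 -> z = 0.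
Proof.
case: z => a b /eqP; rewrite /abs2 /= paddr_eq0 ?sqr_ge0// !sqrf_eq0.
by move=> /andP[/eqP-> /eqP->].
Qed.

Lemma normC_abs2 (z : R[i]) : `|z| = (Num.sqrt (abs2 z))%:C.
Proof. exact: normc_def. Qed.

(** The real part of the inner product. It determines the whole of it, by
    [Im_l2inner], and is easier to handle: real, bilinear and symmetric. *)
Definition rip xi eta : R := complex.Re (l2inner xi eta).

Lemma ripE xi eta : rip xi eta = rsum (fun x => complex.Re (xi x * (eta x)^*)).
Proof. by []. Qed.

Lemma abs2_lty xi : (\esum_(x in [set: X]) (abs2 (xi x))%:E < +oo)%E.
Proof. exact: l2P. Qed.

Lemma rip_abs_summable xi eta :
  abs_summable (fun x => complex.Re (xi x * (eta x)^*)).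
Proof.
apply: (@esumT_lt _ _ _ (fun x => abs2 (xi x) + abs2 (eta x))); last first.
  by apply: esumT_ltD => [x|x||]; rewrite ?abs2_ge0 ?abs2_lty.
move=> x; case: (xi x) (eta x) => [a b] [c d]; rewrite /abs2 /=.
have := sqr_ge0 (a - c); have := sqr_ge0 (a + c).
have := sqr_ge0 (b - d); have := sqr_ge0 (b + d).
by rewrite ler_norml => ? ? ? ?; apply/andP; split; nra.
Qed.

Lemma ripDl xi eta zeta : rip (xi + eta) zeta = rip xi zeta + rip eta zeta.
Proof.
rewrite !ripE -rsumD; try exact: rip_abs_summable.
congr rsum; apply/funext => x; rewrite l2addE mulrDl.
by case: (_ * _) (_ * _) => [? ?] [].
Qed.

Lemma ripC xi eta : rip xi eta = rip eta xi.
Proof.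
rewrite !ripE; congr rsum; apply/funext => x.
by case: (xi x) (eta x) => [a b] [c d] /=; ring.
Qed.

Lemma ripZl (k : R) xi eta : rip (k%:C *: xi) eta = k * rip xi eta.
Proof.
rewrite !ripE -rsumZ; congr rsum; apply/funext => x; rewrite l2scaleE.
by case: (xi x) (eta x) => [a b] [c d] /=; ring.
Qed.

Lemma ripZ_conj k xi eta : rip (k *: xi) eta = rip xi (k^* *: eta).
Proof.
rewrite !ripE; congr rsum; apply/funext => x; rewrite !l2scaleE.
by case: (xi x) (eta x) k => [a b] [c d] [e f] /=; ring.
Qed.

Lemma ripZr k xi eta : rip xi (k *: eta) = rip (k^* *: xi) eta.
Proof. by rewrite ripC ripZ_conj ripC. Qed.

Lemma Im_l2inner xi eta : complex.Im (l2inner xi eta) = rip (- 'i *: xi) eta.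
Proof.
rewrite ripE /=; congr rsum; apply/funext => x.
by case: (xi x) (eta x) => [a b] [c d] /=; ring.
Qed.

Lemma ripDr xi eta zeta : rip xi (eta + zeta) = rip xi eta + rip xi zeta.
Proof. by rewrite ripC ripDl ripC (ripC zeta). Qed.

Lemma ripNl xi eta : rip (- xi) eta = - rip xi eta.
Proof. by rewrite -scaleN1r (_ : -1 = (-1)%:C) ?ripZl ?mulN1r// rmorphN1. Qed.

Lemma ripNr xi eta : rip xi (- eta) = - rip xi eta.
Proof. by rewrite ripC ripNl ripC. Qed.

Lemma rip0l xi : rip 0 xi = 0.
Proof. by rewrite -(scale0r (0 : l2 R X)) (_ : 0 = 0%:C) ?ripZl ?mul0r. Qed.

Lemma rip_sumr (I : Type) (s : seq I) (F : I -> l2 R X) xi :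
  rip xi (\sum_(i <- s) F i) = \sum_(i <- s) rip xi (F i).
Proof.
elim: s => [|i s IH]; first by rewrite !big_nil ripC rip0l.
by rewrite !big_cons ripDr IH.
Qed.

Lemma rip_norm xi : rip xi xi = l2norm xi ^+ 2.
Proof.
rewrite /l2norm sqr_sqrtr ?fine_ge0 ?l2sum_ge0//.
have := @rsumB R X (fun x => abs2 (xi x)) (fun=> 0).
rewrite [X in _ - fine X]esum1// subr0 => <-.
- rewrite ripE; congr rsum; apply/funext => x.
  by case: (xi x) => a b; rewrite /abs2 /=; ring.
- by move=> x; exact: abs2_ge0.
- by [].
- exact: abs2_lty.
- by rewrite esum1 ?ltry.
Qed.

Lemma l2norm_ge0 xi : 0 <= l2norm xi.
Proof. exact: sqrtr_ge0. Qed.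

Lemma rip_ge0 xi : 0 <= rip xi xi.
Proof. by rewrite rip_norm sqr_ge0. Qed.

(** The Cauchy--Schwarz inequality: the discriminant of the nonnegative
    quadratic polynomial t |-> |xi - t eta|^2. *)
Lemma rip_le xi eta : rip xi eta <= l2norm xi * l2norm eta.
Proof.
have quad (t : R) : 0 <= rip xi xi - 2 * t * rip xi eta + t ^+ 2 * rip eta eta.
  suff <- : rip (xi - t%:C *: eta) (xi - t%:C *: eta) =
    rip xi xi - 2 * t * rip xi eta + t ^+ 2 * rip eta eta by exact: rip_ge0.
  rewrite ripDl !ripDr !ripNl !ripNr ripZl (ripC xi (_ *: _)) !ripZl.
  by rewrite (ripC eta (_ *: _)) ripZl (ripC eta xi); ring.
have := l2norm_ge0 xi; have := l2norm_ge0 eta.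
move: quad; rewrite !rip_norm; move: (l2norm xi) (l2norm eta) (rip _ _) => a b p.
rewrite le_eqVlt => quad /predU1P[b0|b0] a0.
  rewrite -b0 mulr0 leNgt; apply/negP => p0.
  have := quad ((a ^+ 2 + 1) / (2 * p)); rewrite -b0 expr0n /= mulr0 addr0.
  have -> : 2 * ((a ^+ 2 + 1) / (2 * p)) * p = a ^+ 2 + 1 by field; lra.
  lra.
have := quad (a / b).
have -> : a ^+ 2 - 2 * (a / b) * p + (a / b) ^+ 2 * b ^+ 2 =
  2 * a / b * (a * b - p) by field; lra.
move: a0; rewrite le_eqVlt => /predU1P[a0 _|a0].
  have := quad (1 / b * p / b); rewrite -a0 mul0r.
  have -> : 0 ^+ 2 - 2 * (1 / b * p / b) * p + (1 / b * p / b) ^+ 2 * b ^+ 2 =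
    - (p / b) ^+ 2 by field; lra.
  rewrite oppr_ge0 => h.
  have /eqP : p / b = 0 by apply/eqP; rewrite -sqrf_eq0 eq_le h sqr_ge0.
  by rewrite mulf_eq0 invr_eq0 (gt_eqF b0) orbF => /eqP->.
by rewrite pmulr_rge0 ?subr_ge0// divr_gt0// mulr_gt0.
Qed.

Lemma rip_norm_le xi eta : `|rip xi eta| <= l2norm xi * l2norm eta.
Proof.
rewrite ler_norml rip_le andbT lerNl -ripNl (le_trans (rip_le _ _))//.
by rewrite {1}/l2norm /l2sum; under eq_esum do rewrite l2oppE abs2N.
Qed.

Lemma l2normD xi eta : l2norm (xi + eta) <= l2norm xi + l2norm eta.
Proof.
rewrite -(@ler_pXn2r _ 2) ?nnegrE ?addr_ge0 ?l2norm_ge0//.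
rewrite -rip_norm ripDl !ripDr (ripC eta) !rip_norm.
have := rip_le xi eta; nra.
Qed.

Lemma abs2_real (k : R) : abs2 k%:C = k ^+ 2.
Proof. by rewrite /abs2 /= expr0n addr0. Qed.

Lemma l2normZ k xi : l2norm (k *: xi) = Num.sqrt (abs2 k) * l2norm xi.
Proof.
rewrite /l2norm -sqrtrM ?abs2_ge0// /l2sum.
under eq_esum do rewrite abs2M.
rewrite esumTZ ?abs2_ge0// => [|x]; last exact: abs2_ge0.
by rewrite fineM// l2sum_fin.
Qed.

Lemma l2normN xi : l2norm (- xi) = l2norm xi.
Proof. by rewrite -scaleN1r l2normZ abs2N abs2_1 sqrtr1 mul1r. Qed.

Lemma l2norm0 : l2norm (0 : l2 R X) = 0 :> R.
Proof. by rewrite -(scale0r (0 : l2 R X)) l2normZ abs2_0 sqrtr0 mul0r. Qed.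

Lemma l2normB xi eta : l2norm (xi - eta) <= l2norm xi + l2norm eta.
Proof. by rewrite -(l2normN eta) l2normD. Qed.

Lemma l2norm_delta (x : X) : l2norm (l2delta R x) = 1.
Proof. by rewrite /l2norm l2sum_delta sqrtr1. Qed.

Lemma l2sumE xi : l2sum xi = (l2norm xi ^+ 2)%:E.
Proof.
by rewrite /l2norm sqr_sqrtr ?fine_ge0 ?l2sum_ge0// fineK ?l2sum_fin.
Qed.

Lemma seq_le_l2norm (s : seq X) xi : uniq s ->
  \sum_(x <- s) abs2 (xi x) <= l2norm xi ^+ 2.
Proof.
move=> us; rewrite -lee_fin -l2sumE.
by apply: seq_le_esumT us => x; exact: abs2_ge0.
Qed.

Lemma l2sum_le_seq (f : X -> Cplx R) (m : R) :
  (forall s : seq X, uniq s -> \sum_(x <- s) abs2 (f x) <= m) ->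
  (l2sum f <= m%:E)%E.
Proof. by move=> fm; apply: esumT_le_seq => // x; exact: abs2_ge0. Qed.

Lemma l2norm_le_l2sum xi (m : R) : 0 <= m -> (l2sum xi <= (m ^+ 2)%:E)%E ->
  l2norm xi <= m.
Proof.
move=> m0; rewrite l2sumE lee_fin ler_pXn2r// ?nnegrE// ?l2norm_ge0//.
Qed.

Lemma l2norm_le_seq xi (m : R) : 0 <= m ->
  (forall s : seq X, uniq s -> \sum_(x <- s) abs2 (xi x) <= m ^+ 2) ->
  l2norm xi <= m.
Proof. by move=> m0 /l2sum_le_seq; exact: l2norm_le_l2sum. Qed.

Lemma abs2_le_l2norm xi x : abs2 (xi x) <= l2norm xi ^+ 2.
Proof. by have := @seq_le_l2norm [:: x] xi isT; rewrite big_seq1. Qed.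

Lemma l2norm_eq0 xi : l2norm xi = 0 -> xi = 0.
Proof.
move=> xi0; apply: l2_eq => x; apply: abs2_eq0; apply/eqP.
by rewrite eq_le abs2_ge0 andbT (le_trans (abs2_le_l2norm xi x))// xi0 expr0n.
Qed.

Lemma rip_eq xi eta : (forall zeta, rip zeta xi = rip zeta eta) -> xi = eta.
Proof.
move=> h; apply/subr0_eq/l2norm_eq0/eqP; rewrite -sqrf_eq0 -rip_norm ripDr ripNr.
by rewrite h subrr.
Qed.

Definition trunc (s : seq X) (f : X -> Cplx R) : l2 R X :=
  \sum_(x <- s) f x *: l2delta R x.

Lemma truncE s f x : uniq s -> trunc s f x = if x \in s then f x else 0.
Proof.
move=> us; rewrite l2bigE; case: ifPn => xs.
  rewrite (bigD1_seq x)//= eqxx mulr1 big1 ?addr0// => y yx.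
  by rewrite eq_sym (negbTE yx) mulr0.
rewrite big_seq big1// => y ys /=; rewrite (_ : x == y = false) ?mulr0//.
by apply: contraNF xs => /eqP->.
Qed.

Lemma trunc_approx xi (e : R) : 0 < e ->
  exists2 s, uniq s & l2norm (xi - trunc s xi) <= e.
Proof.
move=> e0; have [s us] := esumT_approx (fun x => abs2_ge0 (xi x))
  (abs2_lty xi) (exprn_gt0 2 e0).
rewrite -/(l2sum xi) l2sumE /= => xs; exists s => //.
apply: l2norm_le_seq (ltW e0) _ => t ut.
have -> : \sum_(x <- t) abs2 ((xi - trunc s xi) x) =
    \sum_(x <- t | x \notin s) abs2 (xi x).
  rewrite [RHS]big_mkcond; apply: eq_bigr => x _; rewrite l2subE truncE//.
  by case: (x \in s); rewrite ?subrr ?abs2_0 ?subr0.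
have := @seq_le_l2norm (s ++ [seq x <- t | x \notin s]) xi.
rewrite cat_uniq us filter_uniq// andbT /= => /(_ _).
rewrite big_cat big_filter /= => h.
have {}h : \sum_(i <- s) abs2 (xi i) +
    \sum_(i <- t | i \notin s) abs2 (xi i) <= l2norm xi ^+ 2.
  by apply: h; apply/hasPn => x; rewrite mem_filter => /andP[].
lra.
Qed.

Lemma l2norm_trunc s (f : X -> Cplx R) : uniq s ->
  l2norm (trunc s f) ^+ 2 = \sum_(x <- s) abs2 (f x).
Proof.
move=> us; apply/eqP; rewrite eq_le; apply/andP; split; last first.
  apply: le_trans (seq_le_l2norm (trunc s f) us).
  by rewrite big_seq [leRHS]big_seq ler_sum// => x xs; rewrite truncE// xs.
rewrite -lee_fin -l2sumE; apply: l2sum_le_seq => t ut.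
have -> : \sum_(x <- t) abs2 (trunc s f x) =
    \sum_(x <- [seq x <- t | x \in s]) abs2 (f x).
  rewrite big_filter [RHS]big_mkcond; apply: eq_bigr => x _.
  by rewrite truncE//; case: ifP; rewrite ?abs2_0.
rewrite [leRHS](bigID (mem t))/= -[X in X <= _]addr0 lerD//; last first.
  by apply: sumr_ge0 => x _; exact: abs2_ge0.
rewrite -[X in _ <= X]big_filter le_eqVlt; apply/orP; left; apply/eqP.
apply: perm_big; apply: uniq_perm; rewrite ?filter_uniq// => x.
by rewrite !mem_filter andbC.
Qed.

(** Testing against multiples of basis vectors recovers both the real and the
    imaginary parts of the coordinates. *)
Lemma rip_delta (z : R[i]) x xi :
  rip (z *: l2delta R x) xi = complex.Re (z * (xi x)^*).
Proof.
rewrite ripE (@rsum_single _ _ _ x) => [|y /negbTE yx].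
  by rewrite l2scaleE /= eqxx mulr1.
by rewrite l2scaleE /= yx mulr0 mul0r.
Qed.

End hilbert.

(** * Completeness *)

Section completeness.
Variables (R : realType).

Lemma expr2V_lt (c e : R) : 0 < e -> exists n, c * 2^-1 ^+ n < e.
Proof.
move=> e0; have [c0|c0] := leP c 0.
  by exists 0%N; rewrite expr0 mulr1 (le_lt_trans c0).
have [n cn] : exists n : nat, c / e < n%:R.
  by exists (Num.bound (c / e)); apply: archi_boundP; rewrite divr_ge0// ltW.
exists n; rewrite exprVn ltr_pdivrMr ?exprn_gt0//.
rewrite mulrC -ltr_pdivrMr// (lt_trans cn)// -natrX ltr_nat.
exact: ltn_expl.
Qed.

Lemma le_geometric (a b c : R) : (forall n, a <= b + c * 2^-1 ^+ n) -> a <= b.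
Proof.
move=> h; rewrite leNgt; apply/negP => ab.
move: ab; rewrite -subr_gt0 => /(expr2V_lt c)[n].
by have := h n; lra.
Qed.

Lemma geometric_sum_le (V : zmodType) (N : V -> R) (u : nat -> V) (C : R) :
  (forall x y, N (x + y) <= N x + N y) -> N 0 = 0 ->
  (forall n, N (u n.+1 - u n) <= C * 2^-1 ^+ n) ->
  forall n m, N (u (n + m)%N - u n) <= 2 * C * 2^-1 ^+ n - 2 * C * 2^-1 ^+ (n + m).
Proof.
move=> ND N0 uC n; elim=> [|m IH]; first by rewrite addn0 !subrr N0.
rewrite addnS; have := uC (n + m)%N.
have := ND (u (n + m).+1 - u (n + m)%N) (u (n + m)%N - u n).
rewrite addrA subrK exprS; lra.
Qed.

(** The intervals of centre u n and radius 2 C / 2^n meet pairwise, so the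
    supremum of their left ends is common to all of them. *)
Lemma real_geometric_limit (u : nat -> R) (C : R) :
  (forall n, `|u n.+1 - u n| <= C * 2^-1 ^+ n) ->
  exists L, forall n, `|L - u n| <= 2 * C * 2^-1 ^+ n.
Proof.
move=> uC; have C0 : 0 <= C.
  by have := uC 0%N; rewrite expr0 mulr1; apply: le_trans.
have p0 n : 0 <= 2 * C * 2^-1 ^+ n :> R.
  by rewrite !mulr_ge0// exprn_ge0// invr_ge0.
have sumC := geometric_sum_le (@ler_normD R R) (normr0 R) uC.
pose v n := u n - 2 * C * 2^-1 ^+ n.
have vu m n : v m <= u n + 2 * C * 2^-1 ^+ n.
  have := p0 m; have := p0 n; rewrite /v.
  case: (leqP n m) => [nm|/ltnW mn].
    by have := sumC n (m - n)%N; rewrite subnKC// ler_norml => /andP[]; lra.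
  by have := sumC m (n - m)%N; rewrite subnKC// ler_norml => /andP[]; lra.
exists (sup (range v)) => n; rewrite ler_norml; apply/andP; split.
  rewrite lerBrDl; apply: ub_le_sup; last by exists n.
  by exists (u 0%N + 2 * C * 2^-1 ^+ 0) => _ [m _ <-].
rewrite lerBlDl; apply: ge_sup; first by exists (v 0%N), 0%N.
by move=> _ [m _ <-].
Qed.

Section complete.
Variable (X : choiceType).
Implicit Types xi eta : l2 R X.

(** Coordinates converge by the scalar case. That the limit is square summable,
    with the stated rate, is checked on finite sets of coordinates, where
    coordinatewise convergence is convergence in norm. *)
Lemma l2_geometric_limit (u : nat -> l2 R X) (C : R) :
  (forall n, l2norm (u n.+1 - u n) <= C * 2^-1 ^+ n) ->
  exists xi, forall n, l2norm (xi - u n) <= 2 * C * 2^-1 ^+ n.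
Proof.
move=> uC; have C0 : 0 <= C.
  by have := uC 0%N; rewrite expr0 mulr1; apply: le_trans; exact: l2norm_ge0.
have p0 n : 0 <= 2 * C * 2^-1 ^+ n :> R.
  by rewrite !mulr_ge0// exprn_ge0// invr_ge0.
have sumC := geometric_sum_le (@l2normD R X) (l2norm0 R X) uC.
have coord n x : abs2 ((u n.+1 - u n) x) <= (C * 2^-1 ^+ n) ^+ 2.
  by rewrite (le_trans (abs2_le_l2norm _ x))// ler_pXn2r ?nnegrE ?l2norm_ge0//
    (le_trans (l2norm_ge0 _) (uC n)).
have absP (a b : R) : 0 <= b -> a ^+ 2 <= b ^+ 2 -> `|a| <= b.
  by move=> b0; rewrite -(real_normK (num_real a)) ler_pXn2r ?nnegrE.
have Cn n : 0 <= C * 2^-1 ^+ n :> R by rewrite mulr_ge0// exprn_ge0// invr_ge0.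
have lim x : exists z : R[i], forall n,
    abs2 (z - u n x) <= 2 * (2 * C * 2^-1 ^+ n) ^+ 2.
  have [n|a aP] := @real_geometric_limit (fun n => complex.Re (u n x)) C.
    apply: absP => //; apply: le_trans (coord n x); rewrite l2subE.
    case: (u n.+1 x) (u n x) => [p q] [r s]; rewrite /abs2 /=.
    by rewrite lerDl sqr_ge0.
  have [n|b bP] := @real_geometric_limit (fun n => complex.Im (u n x)) C.
    apply: absP => //; apply: le_trans (coord n x); rewrite l2subE.
    case: (u n.+1 x) (u n x) => [p q] [r s]; rewrite /abs2 /=.
    by rewrite lerDr sqr_ge0.
  exists (a +i* b) => n; move: (aP n) (bP n); case: (u n x) => p q /=.
  have sqP (r t : R) : 0 <= t -> `|r| <= t -> r ^+ 2 <= t ^+ 2.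
    by move=> t0 rt; rewrite -(real_normK (num_real r)) ler_pXn2r ?nnegrE.
  move=> /(sqP _ _ (p0 n)) ? /(sqP _ _ (p0 n)) ?; rewrite /abs2 /=; lra.
have [f fP] := boolp.choice lim.
have fu (s : seq X) n : uniq s ->
    \sum_(x <- s) abs2 (f x - u n x) <= (2 * C * 2^-1 ^+ n) ^+ 2.
  move=> us; rewrite -l2norm_trunc// ler_pXn2r ?nnegrE ?l2norm_ge0//.
  (* The truncation of f - u (n + m) to the set s is at most D / 2^m. *)
  pose D := Num.sqrt ((size s)%:R * 2) * (2 * C).
  apply: (@le_geometric _ _ (D * 2^-1 ^+ n)) => m.
  apply: (@le_trans _ _ (l2norm (trunc s (fun x => f x - u (n + m)%N x)) +
      l2norm (trunc s (u (n + m)%N - u n)))).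
    apply: le_trans (l2normD _ _); rewrite le_eqVlt; apply/orP; left.
    apply/eqP; congr l2norm; rewrite -big_split; apply: eq_bigr => x _.
    by rewrite l2subE -[RHS]scalerDl addrA subrK.
  rewrite addrC lerD//.
    apply: le_trans (_ : l2norm (u (n + m)%N - u n) <= _); last first.
      by rewrite (le_trans (sumC n m))// gerBl.
    rewrite -(@ler_pXn2r _ 2)// ?nnegrE ?l2norm_ge0//.
    by rewrite l2norm_trunc// seq_le_l2norm.
  rewrite -(@ler_pXn2r _ 2)// ?nnegrE ?l2norm_ge0//; last first.
    by rewrite /D !mulr_ge0 ?sqrtr_ge0// exprn_ge0// invr_ge0.
  rewrite l2norm_trunc//.
  apply: (@le_trans _ _ (\sum_(x <- s) 2 * (2 * C * 2^-1 ^+ (n + m)) ^+ 2)).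
    by apply: ler_sum => x _; exact: fP.
  rewrite big_const_seq count_predT iter_addr addr0 -[_ *+ size s]mulr_natl.
  rewrite le_eqVlt; apply/orP; left; apply/eqP.
  rewrite /D exprD !exprMn sqr_sqrtr ?mulr_ge0//; ring.
have fl2 : (l2sum f < +oo)%E.
  have : (l2sum (fun x => (f x - u 0%N x)%R) < +oo)%E.
    by apply: le_lt_trans (l2sum_le_seq (fun s => @fu s 0%N)) _; rewrite ltry.
  move=> /(fun h => l2sumD h (l2P (u 0%N))).
  by congr (l2sum _ < _)%E; apply/funext => x; rewrite subrK.
exists (L2 fl2) => n; apply: l2norm_le_seq => // s us.
by rewrite (le_trans _ (fu s n us))//; apply: ler_sum => x _; rewrite l2subE.
Qed.

End complete.

End completeness.

(** * Bounded operators, closures and adjoints *)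

Section operators.
Variables (R : realType) (X : choiceType).
Implicit Types (S T : l2op R X) (xi eta : l2 R X) (k : R).

Definition oplinear T :=
  forall (k : R[i]) xi eta, T (k *: xi + eta) = k *: T xi + T eta.

Lemma opaddE S T xi : (S + T) xi = S xi + T xi. Proof. by []. Qed.
Lemma opoppE T xi : (- T) xi = - T xi. Proof. by []. Qed.
Lemma opsubE S T xi : (S - T) xi = S xi - T xi. Proof. by []. Qed.
Lemma opscaleE (k : R[i]) T xi : (k *: T) xi = k *: T xi. Proof. by []. Qed.
Lemma opzeroE xi : (0 : l2op R X) xi = 0. Proof. by []. Qed.

Section linear.
Variable T : l2op R X.
Hypothesis Tlin : oplinear T.

Lemma oplin0 : T 0 = 0.
Proof.
by have /eqP := Tlin 1 0 0; rewrite !scale1r addr0 -[X in X == _]addr0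
  (inj_eq (addrI _)) eq_sym => /eqP.
Qed.

Lemma oplinD xi eta : T (xi + eta) = T xi + T eta.
Proof. by have := Tlin 1 xi eta; rewrite !scale1r. Qed.

Lemma oplinZ (k : R[i]) xi : T (k *: xi) = k *: T xi.
Proof. by have := Tlin k xi 0; rewrite oplin0 !addr0. Qed.

Lemma oplinN xi : T (- xi) = - T xi.
Proof. by rewrite -scaleN1r oplinZ scaleN1r. Qed.

Lemma oplinB xi eta : T (xi - eta) = T xi - T eta.
Proof. by rewrite oplinD oplinN. Qed.

Lemma oplin_sum (I : Type) (s : seq I) (F : I -> l2 R X) :
  T (\sum_(i <- s) F i) = \sum_(i <- s) T (F i).
Proof.
elim: s => [|i s IH]; first by rewrite !big_nil oplin0.
by rewrite !big_cons oplinD IH.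
Qed.

Lemma oplin_trunc (s : seq X) (f : X -> Cplx R) :
  T (trunc s f) = \sum_(x <- s) f x *: T (l2delta R x).
Proof. by rewrite /trunc oplin_sum; apply: eq_bigr => x _; rewrite oplinZ. Qed.

End linear.

Lemma oplinear0 : oplinear 0.
Proof. by move=> k xi eta; rewrite !opzeroE scaler0 addr0. Qed.

Lemma oplinear_comb (c : R[i]) S T :
  oplinear S -> oplinear T -> oplinear (c *: S + T).
Proof.
move=> Sl Tl k xi eta; rewrite !(opaddE, opscaleE) Sl Tl !scalerDr !scalerA.
by rewrite mulrC -!addrA; congr (_ + _); rewrite addrCA.
Qed.

Lemma oplinear_comp S T : oplinear S -> oplinear T -> oplinear (S \o T).
Proof. by move=> Sl Tl k xi eta /=; rewrite Tl Sl. Qed.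

Lemma norm_leW T k k' : k <= k' -> norm_le T k -> norm_le T k'.
Proof. by move=> kk' Tk xi; rewrite (le_trans (Tk xi))// ler_wpM2r ?l2norm_ge0. Qed.

Lemma norm_le0 k : 0 <= k -> norm_le (0 : l2op R X) k.
Proof. by move=> k0 xi; rewrite opzeroE l2norm0 mulr_ge0 ?l2norm_ge0. Qed.

Lemma norm_leD S T k k' : norm_le S k -> norm_le T k' -> norm_le (S + T) (k + k').
Proof.
move=> Sk Tk xi; rewrite opaddE (le_trans (l2normD _ _))// mulrDl.
exact: lerD.
Qed.

Lemma norm_leN T k : norm_le T k -> norm_le (- T) k.
Proof. by move=> Tk xi; rewrite opoppE l2normN. Qed.

Lemma norm_leB S T k k' : norm_le S k -> norm_le T k' -> norm_le (S - T) (k + k').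
Proof. by move=> Sk Tk; apply: norm_leD => //; exact: norm_leN. Qed.

Lemma norm_leZ (c : R[i]) T k :
  norm_le T k -> norm_le (c *: T) (Num.sqrt (abs2 c) * k).
Proof.
by move=> Tk xi; rewrite opscaleE l2normZ -mulrA ler_wpM2l ?sqrtr_ge0.
Qed.

Lemma norm_le_comp S T k k' : 0 <= k ->
  norm_le S k -> norm_le T k' -> norm_le (S \o T) (k * k').
Proof.
by move=> k0 Sk Tk xi; rewrite (le_trans (Sk _))// -mulrA ler_wpM2l.
Qed.

Lemma bounded_op_linear T : bounded_op T -> oplinear T.
Proof. by case. Qed.

Lemma bounded_op_norm T : bounded_op T -> exists2 k, 0 <= k & norm_le T k.
Proof.
move=> [_ [k Tk]]; exists (Num.max k 0); first by rewrite le_max lexx orbT.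
by apply: norm_leW Tk; rewrite le_max lexx.
Qed.

Lemma bounded_op0 : bounded_op (0 : l2op R X).
Proof. by split; [exact: oplinear0|exists 0; exact: norm_le0]. Qed.

Lemma bounded_op_comb (c : R[i]) S T :
  bounded_op S -> bounded_op T -> bounded_op (c *: S + T).
Proof.
move=> [Sl [k Sk]] [Tl [k' Tk]]; split; first exact: oplinear_comb.
by exists (Num.sqrt (abs2 c) * k + k'); apply: norm_leD => //; exact: norm_leZ.
Qed.

Lemma bounded_opB S T : bounded_op S -> bounded_op T -> bounded_op (S - T).
Proof. by move=> Sb Tb; rewrite addrC -scaleN1r; exact: bounded_op_comb. Qed.

Lemma bounded_op_comp S T : bounded_op S -> bounded_op T -> bounded_op (S \o T).
Proof.
move=> Sb Tb; have [k k0 Sk] := bounded_op_norm Sb.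
have [k' _ Tk] := bounded_op_norm Tb.
split; first by apply: oplinear_comp; exact: bounded_op_linear.
by exists (k * k'); exact: norm_le_comp.
Qed.

(** The approximants occurring in [opclosure] are thus themselves bounded. *)
Lemma bounded_op_near S T k :
  bounded_op T -> oplinear S -> norm_le (T - S) k -> bounded_op S.
Proof.
move=> [_ [k' Tk]] Sl TSk; split=> //; exists (k' + k).
by rewrite -(subKr T S); exact: norm_leB.
Qed.

(** The vectors of finite support are dense, so a bounded operator is
    determined by its values on the canonical basis. *)
Lemma bounded_op_ext S T : bounded_op S -> bounded_op T ->
  (forall x, S (l2delta R x) = T (l2delta R x)) -> S = T.
Proof.
move=> Sb Tb ST; apply/funext => xi; apply/subr0_eq/l2norm_eq0/eqP.
have [k k0 Dk] := bounded_op_norm (bounded_opB Sb Tb).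
have Dl := bounded_op_linear (bounded_opB Sb Tb).
rewrite eq_le l2norm_ge0 andbT; apply/ler_addgt0Pl => e e0; rewrite addr0.
have k1 : 0 < k + 1 by rewrite ltr_wpDl.
have [s us xs] := trunc_approx xi (divr_gt0 e0 k1).
have D0 : (S - T) (trunc s xi) = 0.
  by rewrite oplin_trunc// big1// => x _; rewrite opsubE ST subrr scaler0.
rewrite -opsubE -[(S - T) xi]subr0 -D0 -(oplinB Dl) (le_trans (Dk _))//.
apply: (@le_trans _ _ ((k + 1) * l2norm (xi - trunc s xi))).
  by rewrite ler_wpM2r ?l2norm_ge0// lerDl.
by rewrite mulrC -ler_pdivlMr.
Qed.

Lemma norm_le_eq0 T : (forall e, 0 < e -> norm_le T e) -> T = 0.
Proof.
move=> Te; apply/funext => xi; apply/l2norm_eq0/eqP.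
rewrite eq_le l2norm_ge0 andbT; apply/ler_addgt0Pl => e e0; rewrite addr0.
have x1 : 0 < l2norm xi + 1 by rewrite ltr_wpDl ?l2norm_ge0.
rewrite (le_trans (Te _ (divr_gt0 e0 x1) xi))// mulrAC ler_pdivrMr//.
by rewrite ler_wpM2l ?(ltW e0)// lerDl.
Qed.

(** ** Closures *)

Lemma sub_opclosure (V : set (l2op R X)) T : bounded_op T -> V T -> opclosure V T.
Proof.
by move=> Tb VT; split=> // e e0; exists T; rewrite ?subrr//; exact: norm_le0 (ltW e0).
Qed.

Lemma opclosure_idem (V : set (l2op R X)) : opclosure (opclosure V) `<=` opclosure V.
Proof.
move=> T [Tb TV]; split=> // e e0; have e2 : 0 < e / 2 by rewrite divr_gt0.
have [S [_ /(_ _ e2)[U VU SU]] TS] := TV _ e2; exists U => //.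
by rewrite -(subrK S T) -addrA [e](splitr e); exact: norm_leD.
Qed.

Lemma opclosure_subspace (V : set (l2op R X)) :
  subspace V -> subspace (opclosure V).
Proof.
move=> [V0 VD]; split; first by apply: sub_opclosure => //; exact: bounded_op0.
move=> k S T [Sb SV] [Tb TV]; split; first exact: bounded_op_comb.
move=> e e0; have e2 : 0 < e / 2 by rewrite divr_gt0.
set m := Num.sqrt (abs2 k).
have m1 : 0 < m + 1 by rewrite ltr_wpDl ?sqrtr_ge0.
have [S' VS SS] := SV _ (divr_gt0 e2 m1); have [T' VT TT] := TV _ e2.
exists (k *: S' + T'); first exact: VD.
rewrite opprD addrACA -scalerBr [e](splitr e); apply: norm_leD => //.
apply: norm_leW (norm_leZ k SS); rewrite -/m mulrCA ler_piMr ?(ltW e2)//.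
by rewrite ler_pdivrMr// mul1r lerDl.
Qed.

Lemma subspaceD (V : set (l2op R X)) S T : subspace V -> V S -> V T -> V (S + T).
Proof. by move=> [_ VD] VS VT; rewrite -[S]scale1r; exact: VD. Qed.

Lemma subspaceZ (V : set (l2op R X)) (k : R[i]) T : subspace V -> V T -> V (k *: T).
Proof. by move=> [V0 VD] VT; rewrite -[_ *: _]addr0; exact: VD. Qed.

Lemma subspaceB (V : set (l2op R X)) S T : subspace V -> V S -> V T -> V (S - T).
Proof. by move=> sV VS VT; apply: subspaceD => //; rewrite -scaleN1r; exact: subspaceZ. Qed.

Lemma subspace_sum (V : set (l2op R X)) (I : Type) (s : seq I) (F : I -> l2op R X) :
  subspace V -> (forall i, V (F i)) -> V (\sum_(i <- s) F i).
Proof.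
move=> sV VF; elim: s => [|i s IH]; first by rewrite big_nil; case: sV.
by rewrite big_cons; exact: subspaceD.
Qed.

Lemma lspan_subspace (V : set (l2op R X)) : subspace (lspan V).
Proof.
split=> [|k S T VS VT] W sW VW; first by case: sW.
by apply: sW.2; [exact: VS|exact: VT].
Qed.

Lemma sub_lspan (V : set (l2op R X)) : V `<=` lspan V.
Proof. by move=> T VT W _; apply. Qed.

(** The pointwise limits exist by completeness, at a rate proportional to the
    norm of the vector, so they define a linear and bounded operator. *)
Lemma op_geometric_limit (F : nat -> l2op R X) C :
  (forall n, bounded_op (F n)) ->
  (forall n, norm_le (F n.+1 - F n) (C * 2^-1 ^+ n)) ->
  exists2 T, bounded_op T & forall n, norm_le (T - F n) (2 * C * 2^-1 ^+ n).
Proof.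
move=> Fb FC.
have lim xi : exists eta, forall n,
    l2norm (eta - F n xi) <= 2 * C * l2norm xi * 2^-1 ^+ n.
  have [n|eta etaP] := @l2_geometric_limit _ _ (fun n => F n xi) (C * l2norm xi).
    by have := FC n xi; rewrite opsubE -mulrAC.
  by exists eta => n; rewrite -[2 * C * _]mulrA.
have [T TF] := boolp.choice lim.
have TFn n : norm_le (T - F n) (2 * C * 2^-1 ^+ n).
  by move=> xi; rewrite opsubE -mulrAC; exact: TF.
exists T => //; split; last first.
  have [k _ Fk] := bounded_op_norm (Fb 0%N).
  by exists (2 * C * 2^-1 ^+ 0 + k); rewrite -(subrK (F 0%N) T); exact: norm_leD.
move=> k xi eta; apply/subr0_eq/l2norm_eq0/eqP; rewrite eq_le l2norm_ge0 andbT.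
pose a := 2 * C * l2norm (k *: xi + eta).
pose b := Num.sqrt (abs2 k) * (2 * C * l2norm xi); pose c := 2 * C * l2norm eta.
apply: (@le_geometric _ _ _ (a + (b + c))) => n; rewrite add0r.
have -> : T (k *: xi + eta) - (k *: T xi + T eta) =
  (T (k *: xi + eta) - F n (k *: xi + eta)) -
  (k *: (T xi - F n xi) + (T eta - F n eta)).
  by rewrite (Fb n).1 scalerBr addrACA -opprD opprB addrA subrK.
rewrite (le_trans (l2normB _ _))// mulrDl lerD//.
rewrite (le_trans (l2normD _ _))// mulrDl lerD//.
by rewrite l2normZ -mulrA ler_wpM2l ?sqrtr_ge0.
Qed.

(** ** Adjoints *)

(** For linear operators this is [is_adjoint]: replacing xi by a multiple by i
    recovers the imaginary part of the inner product. *)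
Definition rip_adjoint T T' := forall xi eta, rip (T xi) eta = rip xi (T' eta).

Lemma rip_adjointP T T' : oplinear T -> rip_adjoint T T' <-> is_adjoint T T'.
Proof.
move=> Tl; split=> [TT xi eta|TT xi eta]; last by rewrite /rip TT.
apply/eqP; rewrite eq_complex; apply/andP; split; apply/eqP; first exact: TT.
by rewrite !Im_l2inner -(oplinZ Tl) TT.
Qed.

Lemma rip_adjointC T T' : rip_adjoint T T' -> rip_adjoint T' T.
Proof. by move=> TT xi eta; rewrite ripC -TT ripC. Qed.

Lemma norm_le_adjoint T T' k :
  0 <= k -> norm_le T k -> rip_adjoint T T' -> norm_le T' k.
Proof.
move=> k0 Tk TT eta; have := rip_norm (T' eta); rewrite -TT => E.
have := rip_le (T (T' eta)) eta; rewrite E expr2.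
have := Tk (T' eta); have := l2norm_ge0 (T' eta); have := l2norm_ge0 eta.
move: (l2norm (T _)) (l2norm (T' eta)) (l2norm eta) => a b c c0 b0 abk bac.
move: b0; rewrite le_eqVlt => /predU1P[<-|b0]; first by rewrite mulr_ge0.
rewrite -(ler_pM2r b0) (le_trans bac)// mulrAC ler_wpM2r//.
Qed.

Lemma rip_adjoint_linear T T' : oplinear T -> rip_adjoint T T' -> oplinear T'.
Proof.
move=> Tl TT k xi eta; apply: rip_eq => zeta.
by rewrite -TT !ripDr !ripZr -(oplinZ Tl) !TT.
Qed.

Lemma rip_adjointD S S' T T' : rip_adjoint S S' -> rip_adjoint T T' ->
  rip_adjoint (S + T) (S' + T').
Proof. by move=> SS TT xi eta; rewrite !opaddE ripDl ripDr SS TT. Qed.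

Lemma rip_adjointZ (k : R) T T' : rip_adjoint T T' ->
  rip_adjoint (k%:C *: T) (k%:C *: T').
Proof. by move=> TT xi eta; rewrite !opscaleE ripZl TT ripC -ripZl ripC. Qed.

Lemma rip_adjointB S S' T T' : rip_adjoint S S' -> rip_adjoint T T' ->
  rip_adjoint (S - T) (S' - T').
Proof. by move=> SS TT xi eta; rewrite !opsubE ripDl ripDr ripNl ripNr SS TT. Qed.

Lemma rip_adjoint_comp S S' T T' : rip_adjoint S S' -> rip_adjoint T T' ->
  rip_adjoint (S \o T) (T' \o S').
Proof. by move=> SS TT xi eta /=; rewrite SS TT. Qed.

(** Riesz representation in coordinates: the value of the adjoint at eta has
    x-th coordinate the conjugate of < T delta_x, eta >. *)
Lemma adjoint_exists T : bounded_op T ->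
  exists2 T', bounded_op T' & rip_adjoint T T'.
Proof.
move=> Tb; have Tl := bounded_op_linear Tb; have [k k0 Tk] := bounded_op_norm Tb.
pose f eta x : R[i] := rip (T (l2delta R x)) eta +i* rip (T ('i *: l2delta R x)) eta.
have fE (s : seq X) (g : X -> Cplx R) eta :
    rip (T (trunc s g)) eta = \sum_(x <- s) complex.Re (g x * (f eta x)^*).
  rewrite oplin_trunc// ripC rip_sumr; apply: eq_bigr => x _; rewrite ripC /f.
  case: (g x) => a b /=; have -> : a +i* b = a%:C + b%:C * 'i.
    by apply/eqP; rewrite eq_complex /=; apply/andP; split; apply/eqP; ring.
  rewrite scalerDl ripDl ripZl -scalerA ripZl (oplinZ Tl) /=; ring.
have fl2 eta : (l2sum (f eta) < +oo)%E.
  apply: le_lt_trans (_ : _ <= ((k * l2norm eta) ^+ 2)%:E)%E _; last exact: ltry.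
  apply: l2sum_le_seq => s us; rewrite -l2norm_trunc//.
  have := rip_le (T (trunc s (f eta))) eta; rewrite fE.
  have -> : \sum_(x <- s) complex.Re (f eta x * (f eta x)^*) =
      l2norm (trunc s (f eta)) ^+ 2.
    rewrite l2norm_trunc//; apply: eq_bigr => x _.
    by case: (f eta x) => a b; rewrite /abs2 /=; ring.
  have := Tk (trunc s (f eta)); move: (l2norm_ge0 (trunc s (f eta))) (l2norm_ge0 eta).
  move: (l2norm (T _)) (l2norm (trunc _ _)) (l2norm eta) => a b c b0 c0 ab bac.
  rewrite ler_pXn2r ?nnegrE ?mulr_ge0//.
  move: b0; rewrite le_eqVlt => /predU1P[<-|b0]; first by rewrite mulr_ge0.
  by rewrite -(ler_pM2r b0) -expr2 (le_trans bac)// mulrAC ler_wpM2r.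
pose T' eta := L2 (fl2 eta).
have adj_fin (s : seq X) xi eta : uniq s -> 
    rip (T (trunc s xi)) eta = rip (trunc s xi) (T' eta).
  move=> us; rewrite fE ripC rip_sumr; apply: eq_bigr => x _; rewrite ripC.
  by rewrite rip_delta.
have T'E xi eta : rip (T xi) eta = rip xi (T' eta).
  apply/eqP; rewrite -subr_eq0 -normr_eq0 eq_le normr_ge0 andbT.
  apply/ler_addgt0Pl => e e0; rewrite addr0.
  set c := k * l2norm eta + l2norm (T' eta).
  have c0 : 0 <= c by rewrite addr_ge0 ?mulr_ge0 ?l2norm_ge0.
  have c1 : 0 < c + 1 by rewrite ltr_wpDl.
  have [s us xs] := trunc_approx xi (divr_gt0 e0 c1).
  have -> : rip (T xi) eta - rip xi (T' eta) =
      rip (T (xi - trunc s xi)) eta - rip (xi - trunc s xi) (T' eta).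
    by rewrite (oplinB Tl) !ripDl !ripNl adj_fin//; lra.
  rewrite (le_trans (ler_normB _ _))//.
  apply: (@le_trans _ _ (c * l2norm (xi - trunc s xi))).
    rewrite mulrDl lerD//.
      apply: le_trans (rip_norm_le _ _) _; rewrite mulrAC ler_wpM2r ?l2norm_ge0//.
    by apply: le_trans (rip_norm_le _ _) _; rewrite mulrC.
  apply: (@le_trans _ _ ((c + 1) * l2norm (xi - trunc s xi))).
    by rewrite ler_wpM2r ?l2norm_ge0// lerDl.
  by rewrite mulrC -ler_pdivlMr.
exists T' => //; split; last by exists k; exact: norm_le_adjoint T'E.
exact: rip_adjoint_linear T'E.
Qed.

End operators.

(** * Continuity of homomorphisms of star-algebras *)

Section star_homomorphisms.
Variables (R : realType) (X : choiceType).

Lemma rip_adjoint_limit (F : nat -> l2op R X) T C :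
  (forall n, rip_adjoint (F n) (F n)) ->
  (forall n, norm_le (T - F n) (C * 2^-1 ^+ n)) -> rip_adjoint T T.
Proof.
move=> FF TF xi eta; apply/eqP; rewrite -subr_eq0 -normr_eq0 eq_le normr_ge0 andbT.
apply: (@le_geometric _ _ _ (2 * C * l2norm xi * l2norm eta)) => n; rewrite add0r.
have -> : rip (T xi) eta - rip xi (T eta) =
    rip ((T - F n) xi) eta - rip xi ((T - F n) eta).
  by rewrite !opsubE ripDl ripDr ripNl ripNr FF; lra.
rewrite (le_trans (ler_normB _ _))//.
have := rip_norm_le ((T - F n) xi) eta; have := rip_norm_le xi ((T - F n) eta).
have := ler_wpM2r (l2norm_ge0 eta) (TF n xi).
have := ler_wpM2l (l2norm_ge0 xi) (TF n eta).
move: (l2norm ((T - F n) xi)) (l2norm ((T - F n) eta)) => p q; lra.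
Qed.

Lemma comp_subE (S T U V : l2op R X) : oplinear S ->
  (S \o T) - (U \o V) = (S \o (T - V)) + ((S - U) \o V).
Proof.
by move=> Sl; apply/funext => xi; rewrite opsubE opaddE /= (oplinB Sl) addrA subrK.
Qed.

Section square_root.
Variable A : set (l2op R X).
Hypothesis sA : subspace A.
Hypothesis Ab : forall a, A a -> bounded_op a.
Hypothesis Acl : opclosure A `<=` A.
Hypothesis Amul : forall a b, A a -> A b -> A (a \o b).

(** The contraction k |-> (h + k^2)/2 has a fixed point in the algebra: 1 - k
    is a square root of 1 - h. *)
Lemma square_root_exists h : A h -> rip_adjoint h h -> norm_le h (3 / 4) ->
  exists k, [/\ A k, rip_adjoint k k & (2%:R : R)%:C *: k = h + (k \o k)].
Proof.
move=> Ah hh h34; pose half : R := 2^-1.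
pose F n := iter n (fun k : l2op R X => half%:C *: (h + (k \o k))) 0.
have FS n : F n.+1 = half%:C *: (h + (F n \o F n)) by [].
have half0 : 0 <= half by rewrite invr_ge0.
have halfE : Num.sqrt (abs2 half%:C) = half by rewrite abs2_real sqrtr_sqr ger0_norm.
have AF n : A (F n).
  elim: n => [|n IH]; first by case: sA.
  by rewrite FS; apply: subspaceZ => //; apply: subspaceD => //; exact: Amul.
have Fb n := Ab (AF n); have Fl n := bounded_op_linear (Fb n).
have FF n : rip_adjoint (F n) (F n).
  elim: n => [|n IH]; first by move=> xi eta; rewrite [LHS]rip0l [RHS]ripC rip0l.
  rewrite FS; apply: rip_adjointZ; apply: rip_adjointD => //.
  exact: rip_adjoint_comp.
have Fn n : norm_le (F n) half.
  elim: n => [|n IH]; first exact: norm_le0.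
  rewrite FS; have := norm_leZ half%:C (norm_leD h34 (norm_le_comp half0 IH IH)).
  by apply: norm_leW; rewrite halfE /half; lra.
have Fd n : norm_le (F n.+1 - F n) (1 * 2^-1 ^+ n).
  elim: n => [|n IH].
    rewrite subr0; apply: norm_leW (Fn _); rewrite expr0 /half; lra.
  rewrite [in F n.+2]FS [X in _ - X]FS -scalerBr [h + _]addrC addrKA.
  rewrite comp_subE//; have := norm_leZ half%:C
    (norm_leD (norm_le_comp half0 (Fn n.+1) IH) (norm_le_comp _ IH (Fn n))).
  have p0 : 0 <= 2^-1 ^+ n :> R by rewrite exprn_ge0// invr_ge0.
  rewrite mul1r => /(_ p0); apply: norm_leW; rewrite halfE exprS /half; lra.
have [k kb kF] := op_geometric_limit Fb Fd.
have kl := bounded_op_linear kb; have [m m0 km] := bounded_op_norm kb.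
have ev (e : R) : 0 < e -> exists n, norm_le (k - F n) e.
  move=> /(expr2V_lt (2 * 1))[n /ltW ne]; exists n; exact: norm_leW (kF n).
exists k; split.
- by apply: Acl; split=> // e /ev[n ne]; exists (F n).
- exact: rip_adjoint_limit FF kF.
suff : half%:C *: (h + (k \o k)) - k = 0.
  move=> /subr0_eq E; rewrite -[X in _ *: X = _]E scalerA -rmorphM/= /half.
  by rewrite divff ?pnatr_eq0// scale1r.
apply: norm_le_eq0 => e /(expr2V_lt (half + m + 1))[n /ltW ne].
apply: norm_leW ne _.
have -> : half%:C *: (h + (k \o k)) - k =
    half%:C *: ((k \o k) - (F n \o F n)) - (k - F n.+1).
  rewrite FS !scalerDr scalerN opprB [RHS]addrA addrACA addNr addr0.
  by rewrite [X in _ = X - _]addrC.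
rewrite comp_subE//.
have p0 : 0 <= 2 * 1 * 2^-1 ^+ n :> R by rewrite mulr_ge0// exprn_ge0// invr_ge0.
have := norm_leB (norm_leZ half%:C (norm_leD (norm_le_comp m0 km (kF n))
  (norm_le_comp p0 (kF n) (Fn n)))) (kF n.+1).
by apply: norm_leW; rewrite halfE exprS /half; lra.
Qed.

Variable Y : choiceType.
Variable delta : l2op R X -> l2op R Y.
Hypothesis Aadj : forall a, A a -> exists2 b, A b & rip_adjoint a b.
Hypothesis delta_b : forall a, A a -> bounded_op (delta a).
Hypothesis delta_lin : forall (k : R[i]) a b, A a -> A b ->
  delta (k *: a + b) = k *: delta a + delta b.
Hypothesis delta_mul : forall a b, A a -> A b ->
  delta (a \o b) = delta a \o delta b.
Hypothesis delta_adj : forall a b, A a -> A b -> is_adjoint a b ->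
  is_adjoint (delta a) (delta b).

Let A0 : A 0. Proof. by case: sA. Qed.

Lemma star_hom0 : delta 0 = 0.
Proof.
by have /eqP := delta_lin 1 A0 A0; rewrite !scale1r addr0 -[X in X == _]addr0
  (inj_eq (addrI _)) eq_sym => /eqP.
Qed.

Lemma star_homD a b : A a -> A b -> delta (a + b) = delta a + delta b.
Proof. by move=> Aa Ab'; have := delta_lin 1 Aa Ab'; rewrite !scale1r. Qed.

Lemma star_homZ (k : R[i]) a : A a -> delta (k *: a) = k *: delta a.
Proof. by move=> Aa; have := delta_lin k Aa A0; rewrite star_hom0 !addr0. Qed.

Lemma star_homB a b : A a -> A b -> delta (a - b) = delta a - delta b.
Proof.
move=> Aa Ab'; rewrite -scaleN1r star_homD ?star_homZ ?scaleN1r//.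
exact: subspaceZ.
Qed.

Lemma star_hom_sum (I : Type) (s : seq I) (F : I -> l2op R X) :
  (forall i, A (F i)) ->
  delta (\sum_(i <- s) F i) = \sum_(i <- s) delta (F i).
Proof.
move=> AF; elim: s => [|i s IH]; first by rewrite !big_nil star_hom0.
by rewrite !big_cons star_homD ?IH//; exact: subspace_sum.
Qed.

(** With 1 - k a self-adjoint square root of 1 - a* a, the image of
    1 - a* a is the square of a self-adjoint operator, hence nonnegative. *)
Lemma star_hom_contract a k : A a -> 0 <= k -> k * k <= 3 / 4 ->
  norm_le a k -> norm_le (delta a) 1.
Proof.
move=> Aa k0 k34 ak; have [b Ab' ab] := Aadj Aa.
have bk := norm_le_adjoint k0 ak ab; have ba := rip_adjointC ab.
have lin' c (Ac : A c) := bounded_op_linear (Ab Ac).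
have dlin' c (Ac : A c) := bounded_op_linear (delta_b Ac).
have dadj c c' : A c -> A c' -> rip_adjoint c c' ->
    rip_adjoint (delta c) (delta c').
  move=> Ac Ac' cc'; apply/rip_adjointP; first exact: dlin'.
  by apply: delta_adj => //; apply/rip_adjointP => //; exact: lin'.
have [] := @square_root_exists (b \o a); first exact: Amul.
- exact: rip_adjoint_comp.
- by apply: norm_leW k34 _; exact: norm_le_comp.
move=> r [Ar rr /(congr1 delta)].
rewrite star_homZ// star_homD; [|exact: Amul|exact: Amul].
rewrite (delta_mul Ab' Aa) (delta_mul Ar Ar) => E xi.
have {}E : (2%:R : R)%:C *: delta r xi = delta b (delta a xi) + delta r (delta r xi).
  by have := congr1 (fun f => f xi) E.
have Drr := dadj _ _ Ar Ar rr.
have : l2norm (delta a xi) ^+ 2 =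
    l2norm xi ^+ 2 - l2norm (xi - delta r xi) ^+ 2.
  have {}E := congr1 (rip xi) E.
  rewrite -!rip_norm (dadj _ _ Aa Ab' ab).
  rewrite ripDl !ripDr !ripNl !ripNr (ripC (delta r xi) xi) Drr.
  by move: E; rewrite ripDr ripC ripZl ripC; lra.
have := sqr_ge0 (l2norm (xi - delta r xi)).
have := l2norm_ge0 (delta a xi); have := l2norm_ge0 xi; rewrite mul1r => ? ? ? E'.
by rewrite -(ler_pXn2r (isT : (0 < 2)%N))// E' gerBl.
Qed.

(** Scaling a to norm 1/2 makes 1 - a* a have a square root obtained by
    iteration. The optimal constant is 1, but any constant gives continuity. *)
Lemma star_hom_bounded a k : A a -> norm_le a k -> 0 <= k ->
  norm_le (delta a) (2 * k).
Proof.
move=> Aa ak; rewrite le_eqVlt => /predU1P[k0|k0].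
  have -> : a = 0.
    by apply: norm_le_eq0 => e e0; apply: norm_leW ak; rewrite -k0 ltW.
  by rewrite star_hom0; apply: norm_le0; rewrite -k0 mulr0.
pose c : R := (2 * k)^-1; have c0 : 0 <= c by rewrite invr_ge0 mulr_ge0// ltW.
have cE (r : R) : 0 <= r -> Num.sqrt (abs2 r%:C) = r.
  by move=> r0; rewrite abs2_real sqrtr_sqr ger0_norm.
have ck : c * k = 1 / 2 by rewrite /c; field; lra.
have := norm_leZ c%:C ak; rewrite cE// ck => can.
have cA : A (c%:C *: a) by exact: subspaceZ.
have := star_hom_contract cA _ _ can; rewrite star_homZ//.
have -> : 1 / 2 * (1 / 2) <= 3 / 4 :> R by lra.
move=> /(_ _ isT)-/(_ _)/(norm_leZ (2 * k)%:C); rewrite cE ?mulr_ge0 ?ltW// mulr1.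
rewrite scalerA -rmorphM/= /c divff ?scale1r; first by apply; lra.
by rewrite gt_eqF// mulr_gt0.
Qed.

End square_root.
End star_homomorphisms.

(** * Compactness, continuity and groupoid algebra *)

Section topology.
Variable T : topologicalType.

(** If no finite subfamily covers K, the complements in K of the finite unions
    generate a proper filter, which has no cluster point in K. *)
Lemma compact_subcover (K : set T) (O : T -> set T) : compact K ->
  (forall x, K x -> open (O x) /\ O x x) ->
  exists s : seq T, (forall x, x \in s -> K x) /\
    forall y, K y -> exists2 x, x \in s & O x y.
Proof.
move=> cK OP; apply: contrapT => noc.
pose U (s : seq T) := [set y | K y /\ forall x, x \in s -> ~ O x y].
pose F := [set B : set T | exists2 s : seq T, (forall x, x \in s -> K x) & U s `<=` B].
have FF : Filter F.
  split; first by exists [::].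
    move=> A B [s sK sA] [t tK tB]; exists (s ++ t).
      by move=> x; rewrite mem_cat => /orP[/sK|/tK].
    move=> y [Ky yO]; split; [apply: sA|apply: tB]; split=> // x xs; apply: yO;
      by rewrite mem_cat xs ?orbT.
  by move=> A B AB [s sK sA]; exists s => //; exact: subset_trans AB.
have PF : ProperFilter F.
  split=> // -[s sK sU]; apply: noc; exists s; split=> // y Ky.
  apply: contrapT => h; apply: (sU y); split=> // x xs Oxy.
  by apply: h; exists x.
have [] := cK F PF; first by exists [::] => // y [].
move=> x [Kx clx]; have [Ox Oxx] := OP _ Kx.
have FU : F (U [:: x]) by exists [:: x] => // z; rewrite inE => /eqP->.
have [y [[_ h] Oxy]] := clx _ _ FU (open_nbhs_nbhs (conj Ox Oxx)).
by apply: (h x); rewrite ?mem_head.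
Qed.

Lemma compact_bounded_by (R : realType) (K : set T) (f : T -> R) : compact K ->
  (forall x, K x -> continuous_at x f) ->
  exists M : R, forall x, K x -> f x <= M.
Proof.
move=> cK fc; pose O x := [set y | K y -> f y < f x + 1]°.
have [x Kx|s [_ sK]] := compact_subcover (O := O) cK.
  split; first exact: open_interior.
  have : \forall y \near x, f y < f x + 1.
    by have := cvgr_lt _ (fc x Kx); apply; rewrite ltrDl.
  by move=> fx; apply: filterS fx => y fy _.
exists (\sum_(x <- s) `|f x| + 1) => y Ky; have [x xs /interior_subset Oxy] := sK _ Ky.
rewrite (le_trans (ltW (Oxy Ky)))// lerD2r (big_rem x)//= ler_wpDr//.
  by apply: sumr_ge0.
exact: ler_norm.
Qed.

Lemma continuous_at_sum (K : numFieldType) (V : normedModType K) (I : Type)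
    (s : seq I) (F : I -> T -> V) x :
  (forall i, continuous_at x (F i)) ->
  continuous_at x (fun y => \sum_(i <- s) F i y).
Proof.
move=> Fc; elim: s => [|i s IH].
  rewrite (_ : (fun y => _) = fun=> 0); first exact: cst_continuous.
  by apply/funext => y; rewrite big_nil.
rewrite (_ : (fun y => _) = F i + (fun y => \sum_(i <- s) F i y)).
  by apply: continuousD; [exact: Fc|exact: IH].
by apply/funext => y; rewrite big_cons.
Qed.

Lemma continuous_at_eq_near (S : topologicalType) (f g : T -> S) x :
  (\forall y \near x, f y = g y) -> continuous_at x g -> continuous_at x f.
Proof.
move=> fg gc A; rewrite /= (nbhs_singleton fg) => /gc gA; apply: filterS2 fg gA.
by move=> y /= ->.
Qed.

End topology.

Section complex_topology.
Variables (R : realType) (T : topologicalType).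
Implicit Types f g : T -> Cplx R.

Lemma continuous_conj_at f x : continuous_at x f ->
  continuous_at x (fun y => (f y)^* : Cplx R).
Proof.
move=> /cvgrPdist_lt fc; apply/cvgrPdist_lt => e e0; apply: filterS (fc e e0) => y.
by rewrite -rmorphB/= !normC_abs2 abs2_conj.
Qed.

Lemma continuous_Re_at f x : continuous_at x f ->
  continuous_at x (fun y => complex.Re (f y)).
Proof.
move=> /cvgrPdist_lt fc; apply/cvgrPdist_lt => e e0.
have e0' : 0 < e%:C :> R[i] by rewrite ltcR.
apply: filterS (fc _ e0') => y; rewrite normC_abs2 ltcR => h.
apply: le_lt_trans h; case: (f x) (f y) => [a b] [c d] /=.
by rewrite -sqrtr_sqr ler_wsqrtr// /abs2 /= lerDl sqr_ge0.
Qed.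

End complex_topology.

Section groupoid_algebra.
Variables (G : topologicalType) (Gr : groupoid G).
Implicit Types x y z : G.
Local Notation s := (src Gr).
Local Notation r := (rng Gr).
Local Notation "x ^-1" := (ginv Gr x).
Local Notation "x * y" := (gmul Gr x y).

Lemma src_src x : s (s x) = s x.
Proof. by rewrite -[X in s X](gVmul Gr x) src_gmul// src_ginv. Qed.

Lemma rng_src x : r (s x) = s x.
Proof. by rewrite -[X in r X](gVmul Gr x) rng_gmul ?src_ginv// rng_ginv. Qed.

Lemma src_rng x : s (r x) = r x.
Proof. by rewrite -[X in s X](gmulV Gr x) src_gmul ?src_ginv// rng_ginv. Qed.

Lemma gmulKV x y : s x = s y -> (x * y^-1) * y = x.
Proof. by move=> xy; rewrite -gmulA ?src_ginv ?rng_ginv// gVmul -xy gmul_src. Qed.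

Lemma gmulVK x y : s x = r y -> (x * y) * y^-1 = x.
Proof. by move=> xy; rewrite -gmulA ?rng_ginv// gmulV -xy gmul_src. Qed.

Lemma src_divg x y : s x = s y -> s (x * y^-1) = r y.
Proof. by move=> xy; rewrite src_gmul ?rng_ginv// src_ginv. Qed.

Lemma rng_divg x y : s x = s y -> r (x * y^-1) = r x.
Proof. by move=> xy; rewrite rng_gmul ?rng_ginv. Qed.

Lemma ginv_uniq x y : s x = r y -> x * y = s y -> x = y^-1.
Proof.
move=> xy E; rewrite -[LHS](gmulVK xy) E -rng_ginv -[X in _ = X](rng_mulg Gr).
by [].
Qed.

Lemma ginvK x : (x^-1)^-1 = x.
Proof. by symmetry; apply: ginv_uniq; rewrite ?rng_ginv// gmulV src_ginv. Qed.

Lemma ginv_divg x y : s x = s y -> (x * y^-1)^-1 = y * x^-1.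
Proof.
move=> xy; symmetry; apply: ginv_uniq; first by rewrite src_divg// rng_divg.
by rewrite gmulA ?src_divg ?rng_ginv// gmulKV// gmulV.
Qed.

Lemma divg_divg x y z : s x = s z -> s y = s z ->
  (x * z^-1) * (y * z^-1)^-1 = x * y^-1.
Proof.
move=> xz yz; rewrite ginv_divg// gmulA; first by rewrite gmulKV.
- exact: src_divg.
- by rewrite rng_ginv.
Qed.

Lemma unit_srcP x : units Gr x <-> s x = x.
Proof. by split=> [[y _ <-]|<-]; [exact: src_src|exists x]. Qed.

Lemma rng_unit x : units Gr x -> r x = x.
Proof. by case=> y _ <-; exact: rng_src. Qed.

Lemma divg_unit x y : s x = s y -> units Gr (x * y^-1) -> x = y.
Proof.
move=> xy u; rewrite -(gmulKV xy) -(rng_unit u) rng_divg//.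
have : r x = r y by rewrite -(rng_divg xy) (rng_unit u) -(src_divg xy) ((unit_srcP _).1 u).
by move=> ->; rewrite rng_mulg.
Qed.

Section cocycle.
Variables (Gamma : groupType) (c : G -> Gamma).
Hypothesis cM : forall x y, s x = r y -> c (x * y) = (c x * c y)%g.

Lemma cocycle_unit x : units Gr x -> c x = 1%g.
Proof.
move=> u; have sx := (unit_srcP x).1 u; have := @cM x x.
have xx : x * x = x by rewrite -[X in _ * X]sx gmul_src.
rewrite sx rng_unit// xx => /(_ erefl) E.
by apply: (@mulgI _ (c x)); rewrite -E mulg1.
Qed.

Lemma cocycle_inv x : c x^-1 = (c x)^-1%g.
Proof.
apply: (@mulgI _ (c x)); rewrite mulgV -cM ?rng_ginv// gmulV.
by apply: cocycle_unit; apply/unit_srcP; rewrite src_rng.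
Qed.

Lemma cocycle_div x y : s x = s y -> c (x * y^-1) = (c x * (c y)^-1)%g.
Proof. by move=> xy; rewrite cM ?rng_ginv// cocycle_inv. Qed.

End cocycle.
End groupoid_algebra.

(** * The topology of an etale groupoid *)

Lemma fsum_seq (V : nmodType) (I : choiceType) (A : set I) (t : seq I) (F : I -> V) :
  uniq t -> (forall y, y \in t -> A y) ->
  (forall y, A y -> y \notin t -> F y = 0) ->
  \sum_(y \in A) F y = \sum_(y <- t) F y.
Proof.
move=> ut tA F0; rewrite (fsbig_seq _ F ut); symmetry; apply: fsbig_widen.
  by move=> y; exact: tA.
by move=> y [Ay /= yt]; apply: F0 => //; exact/negP.
Qed.

Section etale_topology.
Variables (G : topologicalType) (Gr : groupoid G).
Hypothesis etG : etale_groupoid Gr.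
Implicit Types x y z : G.
Local Notation s := (src Gr).
Local Notation r := (rng Gr).
Local Notation dv x y := (gmul Gr x (ginv Gr y)).

Lemma etale_hausdorff : hausdorff_space G.
Proof. by case: etG => -[]. Qed.

Lemma ginv_continuous : continuous (ginv Gr).
Proof. by case: etG => _ []. Qed.

Lemma local_homeo_continuous (f : G -> G) (Y : set G) :
  local_homeomorphism f Y -> continuous f.
Proof.
move=> [_ fl] x; have [U [g [[oU Ux] _ fU _ _]]] := fl x.
by move: fU; rewrite continuous_open_subspace// => /(_ x); apply; exact/mem_set.
Qed.

Lemma src_continuous : continuous s.
Proof. by case: etG => _ [_ _ _ /local_homeo_continuous]. Qed.

Lemma rng_continuous : continuous r.
Proof. by case: etG => _ [_ _ /local_homeo_continuous]. Qed.

Lemma ginv_continuous_at f x : continuous_at x f ->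
  continuous_at x (fun y : G => ginv Gr (f y)).
Proof. by move=> fc; apply: (continuous_comp fc); exact: ginv_continuous. Qed.

(** On a neighbourhood U of a unit u on which the source map is injective and
    which it maps into U, an element and its source have the same source. *)
Lemma units_open : open (units Gr).
Proof.
case: (etG) => _ [_ _ _ [_ sl]]; rewrite openE => u /unit_srcP us.
have [U [g [[oU Uu] _ _ _ gK]]] := sl u.
have : nbhs u (U `&` (s @^-1` U)).
  apply: filterI; first exact: open_nbhs_nbhs.
  by apply: src_continuous; rewrite us; exact: open_nbhs_nbhs.
apply: filterS => x [Ux Usx]; apply/unit_srcP.
by rewrite -[LHS]gK// -[RHS]gK// src_src.
Qed.

(** Units being open, the image under s of the domain of a local inverse is open
    in the groupoid, and the local inverse g is continuous on it. *)
Lemma src_chart x : exists (U V : set G) (g : G -> G),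
  [/\ open U /\ U x, open V,
      forall y, U y -> V (s y) /\ g (s y) = y,
      forall v, V v -> U (g v) /\ s (g v) = v &
      forall v, V v -> continuous_at v g].
Proof.
case: (etG) => _ [_ _ _ [_ sl]]; have [U [g [oU [W oW sU] _ gc gK]]] := sl x.
have oV : open (s @` U) by rewrite sU; apply: openI => //; exact: units_open.
exists U, (s @` U), g; split=> //.
- by move=> y Uy; split; [exists y|exact: gK].
- by move=> _ [y Uy <-]; rewrite gK.
- move=> v Vv; move: gc; rewrite continuous_open_subspace// => /(_ v); apply.
  exact/mem_set.
Qed.

Lemma fibre_closed u : closed [set y | s y = u].
Proof.
rewrite (_ : [set _ | _] = s @^-1` [set u])//; apply: closed_comp.
  by move=> ? _; exact: src_continuous.
exact/accessible_closed_set1/hausdorff_accessible/etale_hausdorff.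
Qed.

Lemma compact_fibre (K : set G) u : compact K -> exists2 t : seq G, uniq t &
  forall y, y \in t <-> K y /\ s y = u.
Proof.
move=> cK; have cKu : compact (K `&` [set y | s y = u]).
  by apply: compact_closedI => //; exact: fibre_closed.
have [W WP] := choice src_chart.
have [|t [tK Kt]] := compact_subcover (O := W) cKu.
  by move=> y _; have [V [g [[]]]] := WP y.
exists (undup t); first exact: undup_uniq.
move=> y; rewrite mem_undup; split=> [/tK[]//|Ky].
have [x xt Wxy] := Kt _ Ky; have [V [g [[_ Wx] _ gK _ _]]] := WP x.
rewrite -(gK _ Wxy).2 Ky.2 -(tK _ xt).2 (gK _ Wx).2//.
Qed.

(** The functions h y are compositions of s with local sections through the
    points y of K above s x0. The images under these sections cover a
    neighbourhood of these points; the rest of K is compact, its image under s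
    is closed and misses s x0, so it stays away from the nearby fibres. *)
Lemma compact_fibre_near (K : set G) x0 : compact K ->
  exists (t : seq G) (h : G -> G -> G), [/\ uniq t,
    forall y, y \in t -> continuous_at x0 (h y) &
    \forall x \near x0, [/\ uniq [seq h y x | y <- t],
      forall y, y \in t -> s (h y x) = s x &
      forall z, K z -> s z = s x -> z \in [seq h y x | y <- t]]].
Proof.
move=> cK; have [t ut tP] := compact_fibre (s x0) cK.
have [U UP] := choice src_chart; have [V VP] := choice UP.
have [g gP] := choice VP; pose h y x := g y (s x).
have sx0 : {for x0, continuous s} by exact: src_continuous.
have tV y : y \in t -> V y (s x0).
  by move=> /tP[_ <-]; have [[_ Uy] _ gK _ _] := gP y; exact: (gK _ Uy).1.
have h0 y : y \in t -> h y x0 = y.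
  by rewrite /h => /tP[_ <-]; have [[_ Uy] _ gK _ _] := gP y; exact: (gK _ Uy).2.
have hc y : y \in t -> continuous_at x0 (h y).
  move=> yt; apply: (continuous_comp sx0); have [_ _ _ _ gc] := gP y.
  by apply: gc; exact: tV.
have near_all (P : G -> G -> Prop) (l : seq G) :
    (forall y, y \in l -> \forall x \near x0, P y x) ->
    \forall x \near x0, forall y, y \in l -> P y x.
  elim: l => [|a l IH] lP; first by apply: nearW.
  have Pa := lP a (mem_head _ _).
  have {}IH : \forall x \near x0, forall y, y \in l -> P y x.
    by apply: IH => y yl; apply: lP; rewrite inE yl orbT.
  apply: filterS2 Pa IH => x Pax lx y; rewrite inE => /predU1P[->//|]; exact: lx.
exists t, h; split=> //.
have nV : \forall x \near x0, forall y, y \in t -> V y (s x).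
  apply: near_all => y yt; apply: sx0; apply: open_nbhs_nbhs; split; last exact: tV.
  by have [] := gP y.
have nU : \forall x \near x0, forall y, y \in t -> forall z, z \in t ->
    y != z -> h y x != h z x.
  apply: (near_all) => y yt; apply: near_all => z zt.
  case: (eqVneq y z) => [_|yz]; first exact: nearW.
  have [[A B] /= [/set_mem Ay /set_mem Bz] [oA oB /eqP AB]] :=
    (eq_ind _ id etale_hausdorff _ open_hausdorff) _ _ yz.
  have nA : \forall x \near x0, A (h y x).
    by apply: (hc y yt); rewrite /= h0//; exact: open_nbhs_nbhs.
  have nB : \forall x \near x0, B (h z x).
    by apply: (hc z zt); rewrite /= h0//; exact: open_nbhs_nbhs.
  apply: filterS2 nA nB => x Ax Bx _; apply/eqP => E.
  have /seteqP[AB0 _] := AB; apply: (AB0 (h y x)); split=> //.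
  by rewrite E.
have nK : \forall x \near x0, forall z, K z -> s z = s x ->
    exists2 y, y \in t & U y z.
  pose K' := K `&` ~` (\bigcup_(y in [set` t]) U y).
  have cK' : compact K'.
    apply: compact_closedI => //; apply: open_closedC; apply: bigcup_open => y _.
    by have [[]] := gP y.
  have csK' : closed (s @` K').
    apply: compact_closed; first exact: etale_hausdorff.
    by apply: continuous_compact => //; apply: continuous_subspaceT;
      exact: src_continuous.
  have : nbhs x0 (s @^-1` (~` (s @` K'))).
    apply: sx0; apply: open_nbhs_nbhs; split; first exact: closed_openC.
    move=> [z [Kz Uz] zx]; apply: Uz; exists z; first exact/tP.
    by have [[]] := gP z.
  apply: filterS => x Kx z Kz zx; apply: contrapT => nU'; apply: Kx.
  exists z => //; split=> // -[y yt Uyz]; apply: nU'; by exists y.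
apply: filterS3 nV nU nK => x nVx nUx nKx; split.
- rewrite map_inj_in_uniq// => y z yt zt E; apply/eqP; apply: contrapT => /negP yz.
  by have := nUx _ yt _ zt yz; rewrite E eqxx.
- by move=> y yt; have [_ _ _ gV _] := gP y; exact: (gV _ (nVx _ yt)).2.
- move=> z Kz zx; have [y yt Uyz] := nKx z Kz zx; apply/mapP; exists y => //.
  by rewrite /h -zx; have [_ _ gK _ _] := gP y; rewrite (gK _ Uyz).2.
Qed.

Section fibre_sums.
Variable R : realType.
Implicit Types f g : G -> Cplx R.

Lemma suppP f x : f x != 0 -> supp f x.
Proof. by move=> fx; exact: subset_closure. Qed.

Lemma supp_notin f x : ~ supp f x -> f x = 0.
Proof. by move=> fx; apply/eqP; apply: contrapT => /negP/suppP. Qed.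

(** By the local description of the fibres of the support of g, the sum is near
    each point a finite sum of continuous functions. For Phi x y = f (x y^-1)
    it is a convolution, and for Phi = 1 a push-forward along s. *)
Lemma fibre_sum_continuous (Phi : G -> G -> Cplx R) g :
  continuous g -> compact (supp g) ->
  (forall (h : G -> G) x0, continuous_at x0 h ->
    (\forall x \near x0, s x = s (h x)) -> continuous_at x0 (fun x => Phi x (h x))) ->
  continuous (fun x => \sum_(y \in [set y | s y = s x]) Phi x y * g y).
Proof.
move=> gc cg Pc x0; have [t [h [ut hc hP]]] := compact_fibre_near x0 cg.
apply: (continuous_at_eq_near
    (g := fun x => \sum_(y <- t) (if y \in t then Phi x (h y x) * g (h y x) else 0))).
  apply: filterS hP => x [uh hs Kh].
  rewrite (fsum_seq (t := [seq h y x | y <- t]))//.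
  - rewrite big_map [LHS]big_seq [RHS]big_seq.
    by apply: eq_bigr => y yt; rewrite yt.
  - by move=> _ /mapP[y yt ->]; exact: hs.
  - move=> y ys yh; rewrite (@supp_notin g y) ?mulr0// => Ky.
    by move/negP: yh; apply; exact: Kh.
apply: continuous_at_sum => y; case: (boolP (y \in t)) => [yt|_];
  last exact: cst_continuous.
apply: continuousM; last first.
  by apply: (continuous_comp (hc y yt)); exact: gc.
by apply: Pc; [exact: hc|apply: filterS hP => x [_ hs _]; rewrite hs].
Qed.

End fibre_sums.

Lemma composable_closed : closed (composable Gr).
Proof.
rewrite -[composable Gr]setCK; apply: open_closedC; rewrite openE => -[x y] /= /eqP xy.
have [[A B] /= [/set_mem Ax /set_mem By] [oA oB /eqP AB]] :=
  (eq_ind _ id etale_hausdorff _ open_hausdorff) _ _ xy.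
have nA : nbhs x (s @^-1` A) by apply: src_continuous; exact: open_nbhs_nbhs.
have nB : nbhs y (r @^-1` B) by apply: rng_continuous; exact: open_nbhs_nbhs.
exists (s @^-1` A, r @^-1` B) => // -[x' y'] /= [Ax' By'] E.
have /seteqP[AB0 _] := AB; apply: (AB0 (s x')); split=> //.
by move: By'; rewrite /= -E.
Qed.

Lemma gmul_continuous_at (f g : G -> G) x0 : continuous_at x0 f -> continuous_at x0 g ->
  (\forall x \near x0, s (f x) = r (g x)) -> continuous_at x0 (fun x => gmul Gr (f x) (g x)).
Proof.
move=> fc gc fg; case: (etG) => _ [mc _ _ _].
move: mc => /subspace_continuousP/(_ (f x0, g x0) (nbhs_singleton fg)) mc A nA.
have H : nbhs x0 [set x | composable Gr (f x, g x) -> A (gmul Gr (f x) (g x))].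
  exact: (cvg_pair fc gc (mc A nA)).
by apply: filterS2 fg H => x fgx; exact.
Qed.

End etale_topology.

(** * The reduced algebra *)

Section convolution.
Variables (R : realType) (G : topologicalType) (Gr : groupoid G).
Hypothesis etG : etale_groupoid Gr.
Implicit Types (x y z : G) (f g : G -> Cplx R) (a b S T : l2op R G).
Local Notation s := (src Gr).
Local Notation r := (rng Gr).
Local Notation dv x y := (gmul Gr x (ginv Gr y)).

Lemma norm_coord_le (xi : l2 R G) x : `|xi x| <= (l2norm xi)%:C.
Proof.
rewrite normC_abs2 lecR -[leRHS]ger0_norm ?l2norm_ge0// -sqrtr_sqr.
by rewrite ler_wsqrtr// abs2_le_l2norm.
Qed.

Lemma normC_le_eq0 (z : R[i]) : (forall e : R, 0 < e -> `|z| <= e%:C) -> z = 0.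
Proof.
move=> ze; apply: abs2_eq0; apply/eqP; rewrite eq_le abs2_ge0 andbT -sqrtr_eq0.
rewrite eq_le sqrtr_ge0 andbT; apply/ler_addgt0Pl => e /ze.
by rewrite normC_abs2 lecR addr0.
Qed.

Lemma Cc_sub (P Q : set G) f : P `<=` Q -> Cc P f -> Cc Q f.
Proof. by move=> PQ [fc fk fP]; split=> //; exact: subset_trans fP PQ. Qed.

Lemma Cc_op_sub (P Q : set G) : P `<=` Q -> Cc_op R Gr P `<=` Cc_op R Gr Q.
Proof. by move=> PQ T [f /(Cc_sub PQ) fQ fT]; exists f. Qed.

(** The map y |-> y x^-1 sends the elements in question injectively into a
    source fibre of the inverse of the support, which is compact. *)
Lemma conv_support f x : compact (supp f) -> exists t : seq G, [/\ uniq t,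
  forall y, y \in t -> s y = s x &
  forall y, s y = s x -> f (dv x y) != 0 -> y \in t].
Proof.
move=> cf; have cK : compact (ginv Gr @` supp f).
  apply: continuous_compact => //; apply: continuous_subspaceT.
  exact: ginv_continuous etG.
have [t ut tP] := compact_fibre etG (r x) cK.
exists (undup [seq gmul Gr z x | z <- t]); split; first exact: undup_uniq.
  move=> y; rewrite mem_undup => /mapP[z /tP[_ zx] ->].
  by rewrite src_gmul.
move=> y yx fxy; rewrite mem_undup; apply/mapP; exists (dv y x); last by rewrite gmulKV.
apply/tP; split; last by rewrite src_divg.
by exists (dv x y); [exact: suppP|rewrite ginv_divg].
Qed.

Lemma conv_seq f T x (t : seq G) : is_conv Gr f T -> uniq t ->
  (forall y, y \in t -> s y = s x) ->
  (forall y, s y = s x -> f (dv x y) != 0 -> y \in t) ->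
  forall xi, T xi x = \sum_(y <- t) f (dv x y) * xi y.
Proof.
move=> fT ut tx ft xi; rewrite fT; apply: fsum_seq => // y yx yt.
have [->|/(ft _ yx)] := eqVneq (f (dv x y)) 0; first by rewrite mul0r.
by rewrite (negbTE yt).
Qed.

Lemma conv_linear f T : compact (supp f) -> is_conv Gr f T -> oplinear T.
Proof.
move=> cf fT k xi eta; apply: l2_eq => x.
have [t [ut tx ft]] := conv_support x cf; have E := conv_seq fT ut tx ft.
rewrite l2addE l2scaleE !E mulr_sumr -big_split; apply: eq_bigr => y _.
by rewrite /= mulrDr mulrCA.
Qed.

Lemma supp_comb (k : R[i]) f g :
  supp (fun x => k * f x + g x) `<=` supp f `|` supp g.
Proof.
rewrite /supp -closureU; apply: closure_subset => x /= h.
have [fx|fx] := eqVneq (f x) 0; last by left.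
by right; move: h; rewrite fx mulr0 add0r.
Qed.

Lemma Cc_comb (P : set G) (k : R[i]) f g :
  Cc P f -> Cc P g -> Cc P (fun x => k * f x + g x).
Proof.
move=> [fc fk fP] [gc gk gP]; split.
- by move=> x; apply: cvgD; [apply: cvgM; [exact: cvg_cst|exact: fc]|exact: gc].
- apply: subclosed_compact (@supp_comb k f g); first exact: closed_closure.
  exact: compactU.
- by move=> x /supp_comb[/fP|/gP].
Qed.

Lemma conv_comb (k : R[i]) f g S T : compact (supp f) -> compact (supp g) ->
  is_conv Gr f S -> is_conv Gr g T -> is_conv Gr (fun x => k * f x + g x) (k *: S + T).
Proof.
move=> cf cg fS gT xi x.
have [t [_ tx ft]] := conv_support x cf; have [u [_ ux gu]] := conv_support x cg.
pose w := undup (t ++ u); have uw : uniq w := undup_uniq _.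
have wx y : y \in w -> s y = s x by rewrite mem_undup mem_cat => /orP[/tx|/ux].
have fw y : s y = s x -> f (dv x y) != 0 -> y \in w.
  by move=> yx h; rewrite mem_undup mem_cat ft.
have gw y : s y = s x -> g (dv x y) != 0 -> y \in w.
  by move=> yx h; rewrite mem_undup mem_cat gu ?orbT.
rewrite (fsum_seq uw wx) => [|y yx yw].
  rewrite opaddE opscaleE l2addE l2scaleE (conv_seq fS uw wx fw) (conv_seq gT uw wx gw).
  rewrite mulr_sumr -big_split; apply: eq_bigr => y _ /=.
  by rewrite mulrDl mulrA.
have [->|/(fw _ yx)] := eqVneq (f (dv x y)) 0; last by rewrite (negbTE yw).
have [->|/(gw _ yx)] := eqVneq (g (dv x y)) 0; last by rewrite (negbTE yw).
by rewrite mulr0 addr0 mul0r.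
Qed.

Lemma Cc0 (P : set G) : Cc P (fun=> 0 : Cplx R).
Proof.
have E : supp (fun=> 0 : Cplx R) = set0 :> set G.
  by rewrite /supp (_ : [set _ | _] = set0) ?closure0//; apply/seteqP;
    split=> x //=; rewrite eqxx.
by split; [exact: cst_continuous|rewrite E; exact: compact0|rewrite E].
Qed.

Lemma Cc_op_subspace (P : set G) : subspace (Cc_op R Gr P).
Proof.
split.
  exists (fun=> 0); first exact: Cc0.
  by move=> xi x; rewrite opzeroE l2zeroE fsbig1// => y _; rewrite mul0r.
move=> k S T [f fP fS] [g gP gT]; exists (fun x => k * f x + g x); first exact: Cc_comb.
by case: fP gP => [_ cf _] [_ cg _]; exact: conv_comb.
Qed.

Lemma Cc_op_linear (P : set G) T : Cc_op R Gr P T -> oplinear T.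
Proof. by move=> [f [_ cf _]]; exact: conv_linear. Qed.

(** Unlike [is_conv] this only involves the canonical basis, and so passes
    without convergence issues to limits, products and adjoints; for bounded
    operators and compactly supported f both conditions agree. *)
Definition has_matrix T f :=
  forall z x, T (l2delta R z) x = if s x == s z then f (dv x z) else 0.

Lemma conv_matrix f T : is_conv Gr f T -> has_matrix T f.
Proof.
move=> fT z x; rewrite fT; case: eqP => [xz|xz].
  rewrite (fsum_seq (t := [:: z])) ?big_seq1/= ?eqxx ?mulr1//.
    by move=> y; rewrite inE => /eqP->.
  by move=> y _; rewrite inE /= => /negbTE->; rewrite mulr0.
rewrite fsbig1// => y /= yx; have [yz|_] := eqVneq y z; last by rewrite mulr0.
by case: xz; rewrite -yx yz.
Qed.

Lemma matrix_jmap f T : has_matrix T f -> jmap Gr T = f.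
Proof.
move=> fT; apply/funext => x; rewrite /jmap fT src_src eqxx.
congr f; have := @gmulVK _ Gr x (s x).
by rewrite rng_src gmul_src; apply.
Qed.

Lemma matrix_uniq f S T : bounded_op S -> bounded_op T ->
  has_matrix S f -> has_matrix T f -> S = T.
Proof.
move=> Sb Tb fS fT; apply: bounded_op_ext => // z; apply: l2_eq => x.
by rewrite fS fT.
Qed.

(** A bounded operator is determined by its matrix: on vectors vanishing at the
    finitely many y with f (x y^-1) <> 0, the x-th coordinate is continuous
    and vanishes on vectors of finite support. *)
Lemma matrix_conv f T : bounded_op T -> compact (supp f) -> has_matrix T f -> is_conv Gr f T.
Proof.
move=> Tb cf fT xi x; have Tl := bounded_op_linear Tb; have [k k0 Tk] := bounded_op_norm Tb.
have [t [ut tx ft]] := conv_support x cf.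
have Tfin (u : seq G) (g : G -> Cplx R) :
    T (trunc u g) x = \sum_(y <- u) g y * T (l2delta R y) x.
  by rewrite oplin_trunc// l2bigE.
rewrite (fsum_seq ut tx) => [|y yx yt]; last first.
  have [->|/(ft _ yx)] := eqVneq (f (dv x y)) 0; first by rewrite mul0r.
  by rewrite (negbTE yt).
have -> : \sum_(y <- t) f (dv x y) * xi y = T (trunc t xi) x.
  rewrite Tfin big_seq [RHS]big_seq; apply: eq_bigr => y yt.
  by rewrite fT tx// eqxx mulrC.
apply/subr0_eq; rewrite -l2subE -(oplinB Tl).
set zeta := xi - trunc t xi.
have zt y : y \in t -> zeta y = 0 by move=> yt; rewrite l2subE truncE// yt subrr.
apply: normC_le_eq0 => e e0; have k1 : 0 < k + 1 by rewrite ltr_wpDl.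
have [u uu zu] := trunc_approx zeta (divr_gt0 e0 k1).
have T0 : T (trunc u zeta) x = 0.
  rewrite Tfin big1// => y _; rewrite fT.
  have [yt|yt] := boolP (y \in t); first by rewrite zt// mul0r.
  case: eqP => [xy|_]; last by rewrite mulr0.
  have [->|/(ft _ (esym xy))] := eqVneq (f (dv x y)) 0; first by rewrite mulr0.
  by rewrite (negbTE yt).
rewrite -[T zeta x]subr0 -T0 -l2subE -(oplinB Tl).
rewrite (le_trans (norm_coord_le _ _))// lecR (le_trans (Tk _))//.
apply: (@le_trans _ _ ((k + 1) * l2norm (zeta - trunc u zeta))).
  by rewrite ler_wpM2r ?l2norm_ge0// lerDl.
by rewrite mulrC -ler_pdivlMr.
Qed.

Lemma Cr_bounded a : Cr R Gr a -> bounded_op a. Proof. by case. Qed.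

Lemma Cr_closed : opclosure (Cr R Gr) `<=` Cr R Gr.
Proof. exact: opclosure_idem. Qed.

Lemma Cr_subspace : subspace (Cr R Gr).
Proof. exact/opclosure_subspace/Cc_op_subspace. Qed.

Lemma Cc_op_Cr (P : set G) T : bounded_op T -> Cc_op R Gr P T -> Cr R Gr T.
Proof. by move=> Tb /(Cc_op_sub (@subsetT _ P)); exact: sub_opclosure. Qed.

Lemma jmapB S T x : jmap Gr (S - T) x = jmap Gr S x - jmap Gr T x.
Proof. by rewrite /jmap opsubE l2subE. Qed.

(** Invariance of the matrix of a convolution operator under right translations
    passes to limits, so an element of the reduced algebra is determined by the
    function [jmap]. *)
Lemma Cr_matrix a : Cr R Gr a -> has_matrix a (jmap Gr a).
Proof.
move=> [ab aC] z x; apply/subr0_eq/normC_le_eq0 => e e0.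
have e2 : 0 < e / 2 by rewrite divr_gt0.
have [F [f _ fF] aF] := aC _ e2; have fK := conv_matrix fF.
have h1 : `|(a - F) (l2delta R z) x| <= (e / 2)%:C.
  apply: le_trans (norm_coord_le _ _) _; rewrite lecR (le_trans (aF _))//.
  by rewrite l2norm_delta mulr1.
move: h1; rewrite opsubE l2subE fK; case: ifP => _ h1; last first.
  by rewrite (le_trans h1)// lecR ler_pdivrMr// ler_pMr// ler1n.
have := @jmap_le R G Gr (a - F) (e / 2) (dv x z) aF.
rewrite jmapB (matrix_jmap fK) => h2.
rewrite -[X in `|X|](subrKA (f (dv x z))) (le_trans (ler_normD _ _))//.
rewrite [e in e%:C](splitr e) rmorphD lerD// distrC//.
Qed.

Lemma Cr_jmap_inj a b : Cr R Gr a -> Cr R Gr b -> jmap Gr a = jmap Gr b -> a = b.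
Proof.
move=> Ca Cb ab; apply: (@matrix_uniq (jmap Gr a)); try exact: Cr_bounded.
  exact: Cr_matrix.
by rewrite ab; exact: Cr_matrix.
Qed.

Lemma jmap_continuous a : Cr R Gr a -> continuous (jmap Gr a).
Proof.
move=> [ab aC] x; apply/cvgrPdist_le => /= e e0.
have eR : e = (complex.Re e)%:C.
  by move: e0; case: e => p q; rewrite ltcE /= => /andP[/eqP-> _].
have e0' : 0 < complex.Re e / 3 by move: e0; rewrite eR ltcR => ?; rewrite divr_gt0.
have [F [f [fc _ _] fF] aF] := aC _ e0'.
have h y := @jmap_le R G Gr (a - F) _ y aF.
have jF : jmap Gr F = f by apply/matrix_jmap/conv_matrix.
have e3 : 0 < (complex.Re e / 3)%:C :> R[i] by rewrite ltcR.
have /cvgrPdist_le /(_ _ e3) := fc x; apply: filterS => y fxy.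
have hx := h x; have hy := h y; move: hx hy; rewrite !jmapB jF => hx hy.
rewrite -[X in `|X|](subrKA (f x)) (le_trans (ler_normD _ _))//.
rewrite -[X in _ + `|X|](subrKA (f y)).
rewrite (_ : e = (complex.Re e / 3)%:C + ((complex.Re e / 3)%:C + (complex.Re e / 3)%:C)).
  rewrite lerD// (le_trans (ler_normD _ _))// lerD// distrC//.
by rewrite -!rmorphD/= [LHS]eR; congr (_%:C); lra.
Qed.

(** ** The convolution algebra *)

Definition convf f g : G -> Cplx R :=
  fun x => \sum_(y \in [set y | s y = s x]) f (dv x y) * g y.

Lemma convf_matrix f g S T : is_conv Gr f S -> is_conv Gr g T ->
  has_matrix (S \o T) (convf f g).
Proof.
move=> fS gT z x /=; rewrite fS; have gK := conv_matrix gT.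
case: eqP => [xz|xz]; last first.
  rewrite fsbig1// => y /= yx; rewrite gK; case: eqP => [yz|_]; last by rewrite mulr0.
  by case: xz; rewrite -yx.
rewrite /convf [RHS](@reindex_fsbig _ _ _ _ _ (fun y => dv y z) [set y | s y = s x]).
  apply: eq_fsbigr => y /set_mem /= yx.
  by rewrite gK yx xz eqxx divg_divg// yx.
split.
- by move=> y /= yx; rewrite !src_divg// yx.
- move=> y v /set_mem /= yx /set_mem /= vx E.
  by rewrite -(@gmulKV _ Gr y z (etrans yx xz)) E gmulKV// vx.
- move=> v /=; rewrite src_divg// => vz; exists (gmul Gr v z).
    by rewrite /= src_gmul.
  exact: gmulVK.
Qed.

(** The support of the product lies in the compact product of the two supports. *)
Lemma Cc_convf f g : Cc setT f -> Cc setT g -> Cc setT (convf f g).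
Proof.
move=> [fc cf _] [gc cg _]; split=> [||? _ //].
  apply: fibre_sum_continuous => // h x0 hc hs.
  apply: (@continuous_comp _ _ _ (fun x => dv x (h x)) f); last exact: fc.
  apply: gmul_continuous_at => //; first exact: ginv_continuous_at.
  by apply: filterS hs => x; rewrite rng_ginv.
pose K := composable Gr `&` (supp f `*` supp g).
have cK : compact K.
  rewrite /K setIC; apply: compact_closedI; first exact: compact_setX.
  exact: composable_closed.
have cmK : compact ((fun p => gmul Gr p.1 p.2) @` K).
  apply: continuous_compact => //; case: (etG) => _ [mc _ _ _].
  by apply: continuous_subspaceW mc; exact: subIsetl.
apply: subclosed_compact (cmK) _; first exact: closed_closure.
rewrite [X in _ `<=` X](closure_id _).1; last first.
  exact: (compact_closed (etale_hausdorff etG) cmK).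
apply: closure_subset => x /= /negP xn0; apply: contrapT => nx; apply: xn0.
rewrite /convf fsbig1// => y /= yx.
have [->|fxy] := eqVneq (f (dv x y)) 0; first by rewrite mul0r.
have [->|gy] := eqVneq (g y) 0; first by rewrite mulr0.
case: nx; exists (dv x y, y); last by rewrite /= gmulKV.
by split; [rewrite /composable /= src_divg|split; exact: suppP].
Qed.

Definition starf f : G -> Cplx R := fun x => (f (ginv Gr x))^*.

Lemma Cc_starf f : Cc setT f -> Cc setT (starf f).
Proof.
move=> [fc cf _]; split=> [||? _ //].
  move=> x; apply: continuous_conj_at.
  by apply: continuous_comp; [exact: ginv_continuous etG _|exact: fc].
have cK : compact (ginv Gr @` supp f).
  apply: continuous_compact => //; apply: continuous_subspaceT.
  exact: ginv_continuous etG.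
apply: subclosed_compact (cK) _; first exact: closed_closure.
rewrite [X in _ `<=` X](closure_id _).1; last first.
  exact: (compact_closed (etale_hausdorff etG) cK).
apply: closure_subset => x /=; rewrite /starf conjc_eq0 => fx.
by exists (ginv Gr x); [exact: suppP|rewrite ginvK].
Qed.

Lemma starf_matrix f S T : oplinear S -> is_conv Gr f S -> rip_adjoint S T ->
  has_matrix T (starf f).
Proof.
move=> Sl fS ST z x.
have E : T (l2delta R z) x = (S (l2delta R x) z)^*.
  have Re_eq (u v : R[i]) :
      (forall k : R[i], complex.Re (k * u^*) = complex.Re (k * v)) -> u = v^*.
    move=> uv; have := uv 1; have := uv 'i; case: u v {uv} => [p q] [p' q'] /=.
    by rewrite !(mul0r, mul1r, addr0, subr0, sub0r) => ? ?; congr (_ +i* _); lra.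
  apply: Re_eq => k; rewrite -rip_delta -ST (oplinZ Sl) ripC.
  have := rip_delta 1 z (k *: S (l2delta R x)); rewrite scale1r mul1r => ->.
  by rewrite l2scaleE; case: (k * _).
rewrite E (conv_matrix fS) [s z == _]eq_sym; case: eqP => [xz|_]; last exact: conjc0.
by rewrite /starf ginv_divg.
Qed.

(** The adjoint of convolution by f is convolution by [starf f], and taking
    adjoints is isometric. *)
Lemma Cr_adjoint a : Cr R Gr a -> exists2 b, Cr R Gr b & rip_adjoint a b.
Proof.
move=> [ab aC]; have [b bb adj] := adjoint_exists ab; exists b => //; split=> // e e0.
have [F FC aF] := aC _ e0; have Fb := bounded_op_near ab (Cc_op_linear FC) aF.
have [H Hb FH] := adjoint_exists Fb; exists H; last first.
  exact: norm_le_adjoint (ltW e0) aF (rip_adjointB adj FH).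
case: FC => f fC fF; exists (starf f); first exact: Cc_starf.
apply: matrix_conv => //; first by case: (Cc_starf fC).
exact: starf_matrix (bounded_op_linear Fb) fF FH.
Qed.

Lemma Cr_mul a b : Cr R Gr a -> Cr R Gr b -> Cr R Gr (a \o b).
Proof.
move=> [ab aC] [bb bC]; split; first exact: bounded_op_comp.
have [k k0 ak] := bounded_op_norm ab; have [m m0 bm] := bounded_op_norm bb.
move=> e e0; have e2 : 0 < e / 2 by rewrite divr_gt0.
have k1 : 0 < k + 1 by rewrite ltr_wpDl.
have d0 : 0 < e / 2 / (k + 1) by rewrite divr_gt0.
have [F FC bF] := bC _ d0; have Fb := bounded_op_near bb (Cc_op_linear FC) bF.
have [n n0 Fn] := bounded_op_norm Fb.
have n1 : 0 < n + 1 by rewrite ltr_wpDl.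
have [E EC aE] := aC _ (divr_gt0 e2 n1).
have Eb := bounded_op_near ab (Cc_op_linear EC) aE.
exists (E \o F).
  case: EC FC => f fC fE [g gC gF]; exists (convf f g); first exact: Cc_convf.
  apply: matrix_conv; first exact: bounded_op_comp.
    by case: (Cc_convf fC gC).
  exact: convf_matrix.
rewrite (comp_subE _ _ _ (bounded_op_linear ab)).
have d0' : 0 <= e / 2 / (n + 1) by rewrite divr_ge0 ?ltW.
have := norm_leD (norm_le_comp k0 ak bF) (norm_le_comp d0' aE Fn).
apply: norm_leW; rewrite [leRHS](splitr e) lerD//.
  by rewrite mulrCA ler_piMr ?(ltW e2)// ler_pdivrMr// mul1r lerDl.
by rewrite -mulrA ler_piMr ?(ltW e2)// mulrC ler_pdivrMr// mul1r lerDl.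
Qed.

End convolution.

(** * Homogeneous components *)

Section truncations.
Variables (R : realType) (X : choiceType).
Implicit Types (P : pred X) (xi : l2 R X).

Lemma cut_subproof P xi :
  (l2sum (fun x => if P x then xi x else 0%R) < +oo)%E.
Proof.
apply: esumT_lt (abs2_lty xi) => x.
by case: ifP; rewrite ?abs2_0 ?abs2_ge0.
Qed.

Definition cut P xi : l2 R X := L2 (cut_subproof P xi).

Lemma cutE P xi x : cut P xi x = if P x then xi x else 0.
Proof. by []. Qed.

Lemma l2norm_cut P xi : l2norm (cut P xi) <= l2norm xi.
Proof.
apply: l2norm_le_seq (l2norm_ge0 _) _ => t ut.
apply: le_trans (seq_le_l2norm xi ut); apply: ler_sum => x _.
by rewrite cutE; case: ifP; rewrite ?abs2_0 ?abs2_ge0.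
Qed.

Lemma cut_linear P : oplinear (cut P).
Proof.
move=> k xi eta; apply: l2_eq => x; rewrite l2addE l2scaleE !cutE.
by case: ifP; rewrite ?mulr0 ?addr0.
Qed.

Lemma rip_cut P xi : rip xi (cut P xi) = l2norm (cut P xi) ^+ 2.
Proof.
rewrite -rip_norm !ripE; congr rsum; apply/funext => x; rewrite cutE.
by case: ifP => // _; rewrite rmorph0 !mulr0.
Qed.

(** The components of a vector along the fibres of a map are orthogonal. *)
Lemma sum_cut_le (I : eqType) (c : X -> I) (l : seq I) xi : uniq l ->
  \sum_(i <- l) l2norm (cut (fun x => c x == i) xi) ^+ 2 <= l2norm xi ^+ 2.
Proof.
move=> ul; under eq_bigr do rewrite -rip_cut.
rewrite -rip_sumr.
have -> : \sum_(i <- l) cut (fun x => c x == i) xi = cut (fun x => c x \in l) xi.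
  apply: l2_eq => x; rewrite l2bigE cutE; case: ifPn => xl.
    rewrite (bigD1_seq (c x))//= eqxx big1 ?addr0// => i.
    by rewrite eq_sym => /negbTE->.
  rewrite big_seq big1// => i il; rewrite cutE; case: eqP => // E.
  by rewrite E il in xl.
by rewrite rip_cut ler_pXn2r ?nnegrE ?l2norm_ge0// l2norm_cut.
Qed.

End truncations.

Section grading.
Variables (R : realType) (G : topologicalType) (Gr : groupoid G).
Hypothesis etG : etale_groupoid Gr.
Variables (Gamma : groupType) (c : G -> Gamma).
Hypothesis cP : cocycle Gr c.
Implicit Types (x y z : G) (f g : G -> Cplx R) (a b S T F : l2op R G) (t : Gamma).
Local Notation s := (src Gr).
Local Notation r := (rng Gr).
Local Notation dv x y := (gmul Gr x (ginv Gr y)).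

(** The homogeneous component of degree t of T, namely the sum over u of the
    compressions of T from c^-1(u) to c^-1(tu); the components of a vector
    being orthogonal, it is no larger in norm than T. *)
Lemma component_exists T t : bounded_op T -> exists2 E, bounded_op E &
  forall xi x, E xi x = T (cut (fun y => c y == (t^-1 * c x)%g) xi) x.
Proof.
move=> Tb; have Tl := bounded_op_linear Tb; have [k k0 Tk] := bounded_op_norm Tb.
pose e xi x : Cplx R := T (cut (fun y => c y == (t^-1 * c x)%g) xi) x.
have ek xi (v : seq G) : uniq v ->
    \sum_(x <- v) abs2 (e xi x) <= (k * l2norm xi) ^+ 2.
  move=> uv; pose d x := (t^-1 * c x)%g; pose l := undup (map d v).
  (* At x only the component of xi of degree d x enters. *)
  have -> : \sum_(x <- v) abs2 (e xi x) =
      \sum_(i <- l) \sum_(x <- v | d x == i) abs2 (e xi x).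
    rewrite (exchange_big_dep xpredT)//= [LHS]big_seq [RHS]big_seq.
    apply: eq_bigr => x xv; rewrite big_mkcond (bigD1_seq (d x))/=; last 2 first.
    - by rewrite mem_undup map_f.
    - exact: undup_uniq.
    by rewrite eqxx big1 ?addr0// => i; rewrite eq_sym => /negbTE->.
  rewrite exprMn; apply: le_trans (_ : \sum_(i <- l) k ^+ 2 *
      l2norm (cut (fun y => c y == i) xi) ^+ 2 <= _); last first.
    by rewrite -mulr_sumr ler_wpM2l ?sqr_ge0// sum_cut_le// undup_uniq.
  apply: ler_sum => i _; rewrite -exprMn.
  apply: (@le_trans _ _ (l2norm (T (cut (fun y => c y == i) xi)) ^+ 2)); last first.
    by rewrite ler_pXn2r ?nnegrE ?mulr_ge0 ?l2norm_ge0.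
  apply: le_trans (seq_le_l2norm _ (filter_uniq (fun x => d x == i) uv)).
  by rewrite big_filter; apply: ler_sum => x /eqP <-.
have el2 xi : (l2sum (e xi) < +oo)%E.
  by apply: le_lt_trans (l2sum_le_seq (ek xi)) _; rewrite ltry.
exists (fun xi => L2 (el2 xi)) => //; split; last first.
  by exists k => xi; apply: l2norm_le_seq; rewrite ?mulr_ge0 ?l2norm_ge0//; exact: ek.
move=> m xi eta; apply: l2_eq => x; rewrite l2addE l2scaleE /= /e.
by rewrite cut_linear Tl.
Qed.

Definition gpart t f : G -> Cplx R := fun x => if c x == t then f x else 0.

Lemma component_matrix T (E : l2op R G) f t : oplinear T -> has_matrix Gr T f ->
  (forall xi x, E xi x = T (cut (fun y => c y == (t^-1 * c x)%g) xi) x) ->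
  has_matrix Gr E (gpart t f).
Proof.
move=> Tl fT ET z x; rewrite ET; set P := fun y => _.
have -> : cut P (l2delta R z) = if P z then l2delta R z else 0.
  apply: l2_eq => y; rewrite cutE; have [->|yz] := eqVneq y z; first by case: (P z).
  have d0 : l2delta R z y = 0 by rewrite /= (negbTE yz).
  by rewrite d0; case: (P z); rewrite ?d0; case: (P y).
have -> : T (if P z then l2delta R z else 0) x =
    if P z then T (l2delta R z) x else 0.
  by case: (P z) => //; rewrite (oplin0 Tl).
rewrite fT /gpart /P; case: (s x =P s z) => xz; last by rewrite if_same.
rewrite (cocycle_div cP.1)//; congr (if _ then _ else _).
apply/eqP/eqP => [->|<-]; first by rewrite invgM invgK mulgA mulgV mul1g.
by rewrite invgM invgK mulgVK.
Qed.

Lemma cocycle_near x : \forall y \near x, c y = c x.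
Proof. by apply: open_nbhs_nbhs; split=> //; exact: (cP.2 [set c x]). Qed.

Lemma cocycle_closed t : closed (c @^-1` [set t]).
Proof.
have -> : c @^-1` [set t] = ~` (c @^-1` ~` [set t]) by rewrite preimage_setC setCK.
exact/open_closedC/cP.2.
Qed.

Lemma supp_gpart t f : supp (gpart t f) `<=` supp f `&` c @^-1` [set t].
Proof.
move=> x h; split.
  by move: x h; apply: closure_subset => x /=; rewrite /gpart; case: ifP; rewrite ?eqxx.
apply: cocycle_closed; move: x h; apply: closure_subset => x /=.
by rewrite /gpart; case: (c x =P t) => // _; rewrite eqxx.
Qed.

Lemma Cc_gpart (P : set G) t f : Cc P f -> Cc (P `&` c @^-1` [set t]) (gpart t f).
Proof.
move=> [fc fk fP]; split.
- move=> x; apply: (continuous_at_eq_near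
      (g := fun y => if c x == t then f y else 0)).
    by apply: filterS (cocycle_near x) => y cy; rewrite /gpart cy.
  by case: (c x == t); [exact: fc|exact: cst_continuous].
- apply: subclosed_compact fk _; first exact: closed_closure.
  by move=> x /supp_gpart[].
- by move=> x /supp_gpart[/fP].
Qed.

(** A compactly supported function meets finitely many of the open sets
    c^-1(t), so a convolution operator is the finite sum of its components. *)
Lemma homogeneous_decomposition (P : set G) f F : bounded_op F -> Cc P f -> is_conv Gr f F ->
  exists (l : seq Gamma) (E : Gamma -> l2op R G), 
    [/\ uniq l, F = \sum_(t <- l) E t, forall x, f x != 0 -> c x \in l &
    forall t, [/\ bounded_op (E t), Cc (P `&` c @^-1` [set t]) (gpart t f) &
      is_conv Gr (gpart t f) (E t)]].
Proof.
move=> Fb fP fF; have [_ fk _] := fP.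
have [|v [_ vP]] := compact_subcover (O := fun x => c @^-1` [set c x]) fk.
  by move=> x _; split=> //; exact: cP.2.
have [E EP] := choice (fun t => let: ex_intro2 E Eb EE := component_exists t Fb in
  ex_intro (fun E => bounded_op E /\ _) E (conj Eb EE)).
have EK t : has_matrix Gr (E t) (gpart t f).
  by apply: (component_matrix (bounded_op_linear Fb) (conv_matrix fF)); exact: (EP t).2.
pose l := undup (map c v); exists l, E.
have lP x : f x != 0 -> c x \in l.
  by move=> /suppP/vP[y yv ->]; rewrite mem_undup map_f.
split=> //; first exact: undup_uniq.
- have subb : subspace (@bounded_op R G).
    by split; [exact: bounded_op0|exact: bounded_op_comb].
  apply: (@matrix_uniq _ _ Gr f) => //; last 1 first.
  + move=> z x; have -> : (\sum_(t <- l) E t) (l2delta R z) x =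
        \sum_(t <- l) E t (l2delta R z) x.
      elim: l {lP} => [|t l IH]; first by rewrite !big_nil.
      by rewrite !big_cons opaddE l2addE IH.
    under eq_bigr do rewrite EK.
    case: eqP => xz; last by rewrite big1.
    rewrite /gpart; have [fx|fx] := eqVneq (f (dv x z)) 0.
      by rewrite fx big1// => t _; case: ifP.
    rewrite (bigD1_seq (c (dv x z))) ?lP ?undup_uniq//= eqxx big1 ?addr0// => t.
    by rewrite eq_sym => /negbTE->.
  + by apply: subspace_sum => // t; exact: (EP t).1.
  + exact: conv_matrix.
- move=> t; have fPt := Cc_gpart t fP; split=> //; first exact: (EP t).1.
  by apply: matrix_conv => //; [exact: (EP t).1|case: fPt].
Qed.

End grading.

(** * Tensors, slices and the coaction *)

Section tensors.
Variables (R : realType) (X Y : choiceType).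
Implicit Types (xi : l2 R X) (eta : l2 R Y).

Lemma l2tensorE xi eta p : l2tensor xi eta p = xi p.1 * eta p.2.
Proof. by []. Qed.

Lemma l2tensor_linearl (k : R[i]) xi xi' eta :
  l2tensor (k *: xi + xi') eta = k *: l2tensor xi eta + l2tensor xi' eta.
Proof. by apply: l2_eq => p; rewrite l2addE l2scaleE !l2tensorE mulrDl mulrA. Qed.

Lemma l2tensor_subl xi xi' eta :
  l2tensor (xi - xi') eta = l2tensor xi eta - l2tensor xi' eta.
Proof. by apply: l2_eq => p; rewrite l2subE !l2tensorE l2subE mulrBl. Qed.

Lemma l2norm_tensor xi eta : l2norm (l2tensor xi eta) <= l2norm xi * l2norm eta.
Proof.
apply: l2norm_le_l2sum; first by rewrite mulr_ge0 ?l2norm_ge0.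
rewrite exprMn mulrC; set n := l2norm eta ^+ 2; have n0 : 0 <= n by rewrite sqr_ge0.
rewrite /l2sum (_ : [set: X * Y] = [set: X] `*`` (fun=> [set: Y])); last first.
  by apply/seteqP; split.
rewrite -(@esum_esum _ _ _ _ _ (fun x y => (abs2 (xi x * eta y))%:E)); last first.
  by move=> *; rewrite lee_fin abs2_ge0.
apply: (@le_trans _ _ (\esum_(x in [set: X]) (n * abs2 (xi x))%:E)%E).
  apply: le_esum => x _; under eq_esum do rewrite abs2M.
  have -> : (\esum_(y in [set: Y]) (abs2 (xi x) * abs2 (eta y))%:E =
      (abs2 (xi x))%:E * l2sum eta)%E.
    by apply: esumTZ => *; exact: abs2_ge0.
  by rewrite l2sumE -EFinM mulrC.
have -> : (\esum_(x in [set: X]) (n * abs2 (xi x))%:E = n%:E * l2sum xi)%E.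
  by apply: esumTZ => // *; exact: abs2_ge0.
by rewrite l2sumE -EFinM.
Qed.

Lemma slice_subproof (zeta : l2 R (X * Y)%type) (y : Y) :
  (l2sum (fun x => zeta (x, y)) < +oo)%E.
Proof.
apply: le_lt_trans (_ : _ <= (l2norm zeta ^+ 2)%:E)%E _; last exact: ltry.
apply: l2sum_le_seq => t ut.
have := @seq_le_l2norm R _ [seq (x, y) | x <- t] zeta.
by rewrite big_map map_inj_uniq// => [|x x' []//]; exact.
Qed.

Definition l2slice (y : Y) (zeta : l2 R (X * Y)%type) : l2 R X :=
  L2 (slice_subproof zeta y).

Lemma l2norm_slice y zeta : l2norm (l2slice y zeta) <= l2norm zeta.
Proof.
apply: l2norm_le_seq (l2norm_ge0 _) _ => t ut.
have := @seq_le_l2norm R _ [seq (x, y) | x <- t] zeta.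
by rewrite big_map map_inj_uniq// => [|x x' []//]; exact.
Qed.

(** The slice map id (x) < . delta_y, delta_y' > on operators. *)
Definition slice (y y' : Y) (U : l2op R (X * Y)%type) : l2op R X :=
  fun xi => l2slice y' (U (l2tensor xi (l2delta R y))).

Lemma sliceE y y' U xi x : slice y y' U xi x = U (l2tensor xi (l2delta R y)) (x, y').
Proof. by []. Qed.

Lemma slice_comb y y' (k : R[i]) U V :
  slice y y' (k *: U + V) = k *: slice y y' U + slice y y' V.
Proof. by apply/funext => xi; apply: l2_eq => x. Qed.

Lemma sliceB y y' U V : slice y y' (U - V) = slice y y' U - slice y y' V.
Proof. by rewrite addrC -scaleN1r slice_comb scaleN1r addrC. Qed.

Lemma slice0 y y' : slice y y' 0 = 0.
Proof. by apply/funext => xi; apply: l2_eq => x. Qed.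

Lemma slice_sum y y' (I : Type) (l : seq I) (F : I -> l2op R (X * Y)%type) :
  slice y y' (\sum_(i <- l) F i) = \sum_(i <- l) slice y y' (F i).
Proof.
elim: l => [|i l IH]; first by rewrite !big_nil slice0.
rewrite !big_cons -IH; have := slice_comb y y' 1 (F i) (\sum_(i <- l) F i).
by rewrite !scale1r.
Qed.

Lemma norm_le_slice y y' U k : 0 <= k -> norm_le U k -> norm_le (slice y y' U) k.
Proof.
move=> k0 Uk xi; rewrite (le_trans (l2norm_slice _ _))// (le_trans (Uk _))//.
by rewrite ler_wpM2l// (le_trans (l2norm_tensor _ _))// l2norm_delta mulr1.
Qed.

Lemma bounded_op_slice y y' U : bounded_op U -> bounded_op (slice y y' U).
Proof.
move=> Ub; have [k k0 Uk] := bounded_op_norm Ub; split; last first.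
  by exists k; exact: norm_le_slice.
move=> m xi xi'; apply: l2_eq => x; rewrite sliceE l2tensor_linearl.
by rewrite (bounded_op_linear Ub).
Qed.

Lemma slice_tensor y y' S T U : is_tensor S T U ->
  slice y y' U = (T (l2delta R y) y') *: S.
Proof.
move=> [_ STU]; apply/funext => xi; apply: l2_eq => x.
by rewrite sliceE STU l2tensorE opscaleE l2scaleE mulrC.
Qed.

Lemma slice_min_tensor y y' (V : set (l2op R X)) (W : set (l2op R Y)) U :
  subspace V -> min_tensor V W U -> opclosure V (slice y y' U).
Proof.
move=> sV [Ub UC]; split; first exact: bounded_op_slice.
move=> e e0; have [U' VU UU] := UC _ e0; exists (slice y y' U'); last first.
  by rewrite -sliceB; apply: norm_le_slice => //; exact: ltW.
apply: (VU (fun U => V (slice y y' U))); first split.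
- by rewrite slice0; case: sV.
- by move=> k P Q VP VQ; rewrite slice_comb; exact: sV.2.
- by move=> P [S [T [VS _ STP]]]; rewrite (slice_tensor _ _ STP); exact: subspaceZ.
Qed.

End tensors.

Section translations.
Variables (R : realType) (Gamma : groupType).
Implicit Types t : Gamma.

Lemma lambda_norm_le t : norm_le (@lambda R Gamma t) 1.
Proof.
move=> eta; rewrite mul1r; apply: l2norm_le_seq (l2norm_ge0 _) _ => u uu.
have := @seq_le_l2norm R _ [seq (t^-1 * x)%g | x <- u] eta.
rewrite big_map map_inj_uniq; first by apply.
by move=> x y /mulgI.
Qed.

Lemma lambda_bounded t : bounded_op (@lambda R Gamma t).
Proof.
split; last by exists 1; exact: lambda_norm_le.
by move=> k xi eta; apply: l2_eq => x.
Qed.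

Lemma lambda_Crg t : Crg R Gamma (@lambda R Gamma t).
Proof.
apply: sub_opclosure; first exact: lambda_bounded.
by apply: sub_lspan; exists t.
Qed.

Lemma lambda_delta1 t u : @lambda R Gamma t (l2delta R 1%g) u = (u == t)%:R.
Proof.
rewrite /=; congr (_%:R); congr (nat_of_bool _).
apply/eqP/eqP => [tu|->]; last by rewrite mulVg.
by apply: (@mulgI _ t^-1%g); rewrite tu mulVg.
Qed.

End translations.

Section coaction.
Variables (R : realType) (G : topologicalType) (Gr : groupoid G).
Hypothesis etG : etale_groupoid Gr.
Variables (Gamma : groupType) (c : G -> Gamma).
Hypothesis cP : cocycle Gr c.
Variable delta : l2op R G -> l2op R (G * Gamma)%type.
Hypothesis deltaP : induced_coaction Gr c delta.
Implicit Types (x y z : G) (f g : G -> Cplx R) (a b S T F : l2op R G) (t : Gamma).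
Local Notation lam t := (@lambda R Gamma t).

Let sCr := Cr_subspace R etG.

Lemma coaction_bounded a : Cr R Gr a -> bounded_op (delta a).
Proof. by case: deltaP => -[h _ _ _] _ _ /h[]. Qed.

Lemma coaction_comb (k : R[i]) a b : Cr R Gr a -> Cr R Gr b ->
  delta (k *: a + b) = k *: delta a + delta b.
Proof. by case: deltaP => -[_ h _ _] _ _; exact: h. Qed.

(** The coaction is only prescribed on homogeneous convolution operators; this
    bound, valid for any homomorphism of star-algebras, is what extends
    identities to all of the reduced algebra. *)
Lemma coaction_norm_le a k : Cr R Gr a -> 0 <= k -> norm_le a k ->
  norm_le (delta a) (2 * k).
Proof.
case: deltaP => -[_ dlin dmul dadj] _ _ Ca k0 ak.
apply: (@star_hom_bounded _ _ (Cr R Gr)) => //.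
- exact: Cr_bounded.
- exact: Cr_closed.
- exact: Cr_mul.
- exact: Cr_adjoint.
- exact: coaction_bounded.
Qed.

Lemma coactionB a b : Cr R Gr a -> Cr R Gr b -> delta (a - b) = delta a - delta b.
Proof. exact: (star_homB sCr coaction_comb). Qed.

Lemma coaction_sum (I : Type) (l : seq I) (F : I -> l2op R G) :
  (forall i, Cr R Gr (F i)) -> delta (\sum_(i <- l) F i) = \sum_(i <- l) delta (F i).
Proof. exact: (star_hom_sum sCr coaction_comb). Qed.

Lemma coaction_near a F e : Cr R Gr a -> Cr R Gr F -> 0 <= e -> norm_le (a - F) e ->
  norm_le (delta a - delta F) (2 * e).
Proof.
move=> Ca CF e0 aF; rewrite -coactionB//; apply: coaction_norm_le => //.
exact: subspaceB.
Qed.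

(** An operator at finite distance from a bounded one is bounded, so the
    approximants lie in the reduced algebra, where delta is controlled. *)
Lemma Cc_op_approx (P : set G) a e : opclosure (Cc_op R Gr P) a -> 0 < e ->
  exists F, [/\ Cc_op R Gr P F, bounded_op F, Cr R Gr F & norm_le (a - F) e].
Proof.
move=> [ab aC] e0; have [F PF aF] := aC _ e0.
have Fb := bounded_op_near ab (Cc_op_linear etG PF) aF.
by exists F; split=> //; exact: Cc_op_Cr PF.
Qed.

Lemma coaction_component (P : set G) f t (E : l2op R G) :
  Cc (P `&` c @^-1` [set t]) f -> is_conv Gr f E ->
  is_tensor E (lam t) (delta E).
Proof.
case: deltaP => _ _ h fP fE; apply: (h _ f) => //.
  exact: Cc_sub fP.
by case: fP => _ _ fP; apply: subset_trans fP _; exact: subIsetr.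
Qed.

(** By [slice_tensor], the slice at t of F_u (x) lambda_u is F_u when u = t and 0
    otherwise. *)
Lemma coaction_slice_conv (P : set G) F f t : bounded_op F -> Cc P f -> is_conv Gr f F ->
  jmap Gr (slice 1%g t (delta F)) = gpart c t f.
Proof.
move=> Fb fP fF.
have [l [E [ul FE lP EP]]] := homogeneous_decomposition etG cP Fb fP fF.
have CE u : Cr R Gr (E u).
  by have [Eb fE EE] := EP u; apply: (Cc_op_Cr Eb (ex_intro2 _ _ _ fE EE)).
have -> : slice 1%g t (delta F) = \sum_(u <- l) ((t == u)%:R : R[i]) *: E u.
  rewrite FE coaction_sum// slice_sum; apply: eq_bigr => u _.
  have [_ fE EE] := EP u.
  by rewrite (slice_tensor _ _ (coaction_component fE EE)) lambda_delta1.
apply/funext => x; rewrite /jmap.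
have -> : (\sum_(u <- l) ((t == u)%:R : R[i]) *: E u) (l2delta R (src Gr x)) x =
    \sum_(u <- l) ((t == u)%:R : R[i]) * gpart c u f x.
  elim: l {ul FE lP} => [|u l IH]; first by rewrite !big_nil.
  rewrite !big_cons opaddE l2addE IH opscaleE l2scaleE; congr (_ * _ + _).
  by have [_ _ EE] := EP u; rewrite -(matrix_jmap (conv_matrix EE)).
rewrite /gpart; have [fx|/lP cx] := eqVneq (f x) 0.
  by rewrite fx if_same big1// => u _; rewrite if_same mulr0.
rewrite (bigD1_seq (c x))//= eqxx big1 ?addr0 => [|u]; last first.
  by rewrite eq_sym => /negbTE->; rewrite mulr0.
by rewrite eq_sym; case: eqP; rewrite ?mul1r ?mul0r.
Qed.

(** Both sides are continuous in a, the left one because the coaction is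
    bounded, and they agree on convolution operators. *)
Lemma jmap_slice a t : Cr R Gr a ->
  jmap Gr (slice 1%g t (delta a)) = gpart c t (jmap Gr a).
Proof.
move=> Ca; apply/funext => x; apply/subr0_eq/normC_le_eq0 => e e0.
have e3 : 0 < e / 3 by rewrite divr_gt0.
have [F [[f fP fF] Fb CF aF]] := Cc_op_approx Ca e3.
have jF := matrix_jmap (conv_matrix fF).
have h1 : `|jmap Gr (slice 1%g t (delta a)) x - gpart c t f x| <= (2 * (e / 3))%:C.
  rewrite -(coaction_slice_conv t Fb fP fF) -jmapB -sliceB; apply: jmap_le.
  apply: norm_le_slice; first by rewrite mulr_ge0// ltW.
  by apply: coaction_near => //; exact: ltW.
have h2 : `|gpart c t f x - gpart c t (jmap Gr a) x| <= (e / 3)%:C.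
  rewrite /gpart; case: eqP => _; last by rewrite subrr normr0 lecR ltW.
  by rewrite distrC -jF -jmapB; exact: jmap_le.
rewrite -[X in `|X|](subrKA (gpart c t f x)) (le_trans (ler_normD _ _))//.
rewrite (_ : e = 2 * (e / 3) + e / 3); last by lra.
by rewrite rmorphD lerD.
Qed.

Lemma is_tensor_limit a t : Cr R Gr a ->
  (forall e : R, 0 < e -> exists F, [/\ Cr R Gr F, norm_le (a - F) e &
    is_tensor F (lam t) (delta F)]) ->
  is_tensor a (lam t) (delta a).
Proof.
move=> Ca aC; split; first exact: coaction_bounded.
move=> xi eta; apply/subr0_eq/l2norm_eq0/eqP; rewrite eq_le l2norm_ge0 andbT.
pose m := l2norm xi * l2norm eta; have m0 : 0 <= m by rewrite mulr_ge0 ?l2norm_ge0.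
apply/ler_addgt0Pl => e e0; rewrite addr0.
(* The two errors below are at most 2 d m and d m when a - F is at most d. *)
have m1 : 0 < 3 * (m + 1) by rewrite mulr_gt0// ltr_wpDl.
have d0 : 0 < e / (3 * (m + 1)) by rewrite divr_gt0.
have [F [CF aF [_ FT]]] := aC _ d0; set d := e / _ in d0 aF.
have -> : delta a (l2tensor xi eta) - l2tensor (a xi) (lam t eta) =
    (delta a - delta F) (l2tensor xi eta) - l2tensor ((a - F) xi) (lam t eta).
  by rewrite !opsubE l2tensor_subl FT opprB addrA subrK.
rewrite (le_trans (l2normB _ _))//.
apply: (@le_trans _ _ (2 * d * m + d * m)).
  apply: lerD.
    rewrite (le_trans (coaction_near Ca CF (ltW d0) aF _))//.
    by rewrite ler_wpM2l ?l2norm_tensor// mulr_ge0// ltW.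
  rewrite (le_trans (l2norm_tensor _ _))// /m mulrA ler_pM ?l2norm_ge0//.
  by have := @lambda_norm_le R Gamma t eta; rewrite mul1r.
have -> : 2 * d * m + d * m = d * (3 * m) by ring.
rewrite /d mulrAC ler_pdivrMr// ler_wpM2l ?(ltW e0)//; lra.
Qed.

Section fourier.
Hypothesis fcap : FCAP R Gr.

(** The approximation property provides approximants supported in c^-1(t), and
    delta is prescribed on these. *)
Lemma homogeneous_spectral a t : Cr R Gr a ->
  (forall x, jmap Gr a x != 0 -> c x = t) -> spectral_subspace Gr delta t a.
Proof.
move=> Ca supp_t; split=> //; apply: is_tensor_limit => // e e0.
have [F [[f fP fF] Fb CF aF]] := Cc_op_approx (fcap Ca) e0; exists F; split=> //.
apply: (@coaction_component setT f) fF; apply: Cc_sub fP => x h; split=> //.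
exact: supp_t.
Qed.

(** The slice at t of a (x) lambda_t is a itself. *)
Lemma spectral_subspace_homogeneous a t x : spectral_subspace Gr delta t a ->
  jmap Gr a x != 0 -> c x = t.
Proof.
move=> [Ca aT]; have := congr1 (fun f => f x) (jmap_slice t Ca).
rewrite (slice_tensor _ _ aT) lambda_delta1 eqxx scale1r /gpart => ->.
by case: (c x =P t) => //; rewrite eqxx.
Qed.

End fourier.
End coaction.

(** * Spectral and invariant bimodules *)

Section spectral_bimodules.
Variables (R : realType) (G : topologicalType) (Gr : groupoid G).
Hypothesis etG : etale_groupoid Gr.
Variables (Gamma : groupType) (c : G -> Gamma).
Hypothesis cP : cocycle Gr c.
Variable delta : l2op R G -> l2op R (G * Gamma)%type.
Hypothesis deltaP : induced_coaction Gr c delta.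
Hypothesis fcap : FCAP R Gr.
Implicit Types (x y z : G) (f g : G -> Cplx R) (a b S T F : l2op R G) (t : Gamma).
Implicit Type M : set (l2op R G).
Local Notation lam t := (@lambda R Gamma t).

Lemma sub_Asub_spectrum M : M `<=` Cr R Gr -> M `<=` Asub Gr (spectrum Gr M).
Proof.
move=> MC a Ma; split=> [|x]; first exact: MC.
move=> nx; apply/eqP; apply: contrapT => /negP ax; apply: nx.
by exists a.
Qed.

Lemma Asub_supp' (P : set G) a : Asub Gr P a -> supp' Gr a `<=` P.
Proof.
move=> [_ aP] x; rewrite /supp' /= => ax; apply: contrapT => /aP E.
by rewrite E eqxx in ax.
Qed.

(** By the approximation property, an element of A(sigma(M)) is a limit of
    sums of homogeneous convolution operators supported in sigma(M). *)
Lemma spectral_of_homogeneous M : closed_subspace M -> M `<=` Cr R Gr ->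
  (forall t F, Cr R Gr F -> Cc_op R Gr (spectrum Gr M `&` c @^-1` [set t]) F -> M F) ->
  spectral Gr M.
Proof.
move=> [sM Mcl] MC MF; apply/seteqP; split; first exact: sub_Asub_spectrum.
move=> a aP; have [Ca _] := aP; apply: Mcl; split; first exact: Cr_bounded Ca.
move=> e e0; have [F [[f fP fF] Fb _ aF]] := Cc_op_approx etG (fcap Ca) e0.
exists F => //; have fM := Cc_sub (Asub_supp' aP) fP.
have [l [E [_ -> _ EP]]] := homogeneous_decomposition etG cP Fb fM fF.
apply: subspace_sum => // t; have [Eb fE EE] := EP t.
have EC : Cc_op R Gr (spectrum Gr M `&` c @^-1` [set t]) (E t) by exists (gpart c t f).
exact: MF (Cc_op_Cr Eb EC) EC.
Qed.

(** The homogeneous components of the approximants of a, being supported in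
    sigma(M), belong to A(sigma(M)) = M. *)
Lemma spectral_invariant M : closed_subspace M ->
  spectral Gr M -> coaction_invariant delta M.
Proof.
move=> [sM Mcl] Msp a Ma; have aP : Asub Gr (spectrum Gr M) a by rewrite -Msp.
have [Ca _] := aP; split; first exact (coaction_bounded deltaP Ca).
move=> e e0; have e2 : 0 < e / 2 by rewrite divr_gt0.
have [F [[f fP fF] Fb CF aF]] := Cc_op_approx etG (fcap Ca) e2.
exists (delta F); last first.
  have := coaction_near etG deltaP Ca CF (ltW e2) aF.
  by rewrite mulrCA divff ?mulr1// pnatr_eq0.
have fM := Cc_sub (Asub_supp' aP) fP.
have [l [E [_ -> _ EP]]] := homogeneous_decomposition etG cP Fb fM fF.
have CE t : Cr R Gr (E t).
  by have [Eb fE EE] := EP t; apply: (Cc_op_Cr Eb (ex_intro2 _ _ _ fE EE)).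
rewrite (coaction_sum etG deltaP)//; refine (subspace_sum _ (lspan_subspace _) _).
move=> t; have [Eb fE EE] := EP t; apply sub_lspan; exists (E t), (lam t).
split; [|exact: lambda_Crg|exact (coaction_component deltaP fE EE)].
rewrite Msp; split=> // x nx; rewrite (matrix_jmap (conv_matrix EE)).
apply/eqP; apply: contrapT => /negP/suppP h; apply: nx.
by case: fE => _ _ /(_ _ h)[].
Qed.

Lemma invariant_slice M t b : closed_subspace M -> coaction_invariant delta M ->
  M b -> M (slice 1%g t (delta b)).
Proof. by move=> [sM Mcl] Minv /Minv/(slice_min_tensor 1%g t sM)/Mcl. Qed.

(** The component of degree t of an element of M is a slice of its image under
    the coaction, hence belongs to M by invariance. *)
Lemma invariant_component M t x : closed_subspace M -> M `<=` Cr R Gr ->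
  coaction_invariant delta M -> spectrum Gr M x -> c x = t ->
  exists b, [/\ M b, spectral_subspace Gr delta t b & jmap Gr b x != 0].
Proof.
move=> Mcs MC Minv [b Mb bx] cx; exists (slice 1%g t (delta b)).
have Mb' := invariant_slice t Mcs Minv Mb; have E := jmap_slice etG cP deltaP t (MC _ Mb).
split=> //; last by rewrite E /gpart cx eqxx.
apply: (homogeneous_spectral etG deltaP fcap (MC _ Mb')) => y.
by rewrite E /gpart; case: (c y =P t) => //; rewrite eqxx.
Qed.

Lemma spectral_component M t : spectral Gr M ->
  spectral Gr (M `&` spectral_subspace Gr delta t).
Proof.
move=> Msp; set N := _ `&` _.
have NC : N `<=` Cr R Gr by move=> a [_ []].
apply/seteqP; split; first exact: sub_Asub_spectrum.
move=> a [Ca aN]; split.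
  rewrite Msp; split=> // x nx; apply: aN => -[b [Mb _] bx]; apply: nx.
  by exists b.
apply: (homogeneous_spectral etG deltaP fcap Ca) => x ax.
have [b [_ bt] bx] : spectrum Gr N x.
  by apply: contrapT => /aN E; rewrite E eqxx in ax.
exact: (spectral_subspace_homogeneous etG cP deltaP bt bx).
Qed.

Lemma invariant_spectral_of_components M : closed_subspace M -> M `<=` Cr R Gr ->
  coaction_invariant delta M ->
  (forall t, spectral Gr (M `&` spectral_subspace Gr delta t)) -> spectral Gr M.
Proof.
move=> Mcs MC Minv Msp; apply: spectral_of_homogeneous => // t F CF [f fP fF].
suff : (M `&` spectral_subspace Gr delta t) F by case.
rewrite Msp; split=> // x nx; rewrite (matrix_jmap (conv_matrix fF)).
apply/eqP; apply: contrapT => /negP/suppP fx; apply: nx.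
case: fP => _ _ /(_ _ fx)[Mx cx].
by have [b [Mb bt bx]] := invariant_component Mcs MC Minv Mx cx; exists b.
Qed.

End spectral_bimodules.

(** * Bisections *)

Section bisections.
Variables (R : realType) (G : topologicalType) (Gr : groupoid G).
Hypothesis etG : etale_groupoid Gr.
Variables (Gamma : groupType) (c : G -> Gamma).
Hypothesis cP : cocycle Gr c.
Implicit Types (x y z : G) (f g h w : G -> Cplx R) (a b F : l2op R G) (t : Gamma).
Implicit Type M : set (l2op R G).
Local Notation s := (src Gr).
Local Notation r := (rng Gr).
Local Notation dv x y := (gmul Gr x (ginv Gr y)).

(** Since x y^-1 is a unit only for y = x, the convolution sum reduces to a
    single term, and boundedness of h makes it an operator on l^2. *)
Lemma unit_multiplier h (m : R) : (forall x, ~ units Gr x -> h x = 0) ->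
  (forall x, abs2 (h x) <= m) ->
  exists2 b : l2op R G, is_conv Gr h b & forall xi x, b xi x = h (r x) * xi x.
Proof.
move=> hU hm; pose e (xi : l2 R G) x : Cplx R := h (r x) * xi x.
have el2 xi : (l2sum (e xi) < +oo)%E.
  apply: le_lt_trans (_ : _ <= (m * l2norm xi ^+ 2)%:E)%E _; last exact: ltry.
  apply: l2sum_le_seq => u uu.
  apply: (@le_trans _ _ (\sum_(x <- u) m * abs2 (xi x))).
    by apply: ler_sum => x _; rewrite /e abs2M ler_wpM2r ?abs2_ge0.
  rewrite -mulr_sumr; case: u uu => [|x u] uu.
    rewrite big_nil mulr0.
    have [[x _]|nG] := pselect (exists x : G, True).
      by rewrite mulr_ge0 ?sqr_ge0// (le_trans _ (hm x))// abs2_ge0.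
    rewrite (_ : xi = 0) ?l2norm0 ?expr0n ?mulr0//.
    by apply: l2_eq => x; case: nG; exists x.
  by rewrite ler_wpM2l ?seq_le_l2norm// (le_trans _ (hm x))// abs2_ge0.
exists (fun xi => L2 (el2 xi)) => // xi x.
rewrite (fsum_seq (t := [:: x])) ?big_seq1 ?gmulV//.
  by move=> y; rewrite inE => /eqP->.
move=> y yx; rewrite inE => yx'; rewrite hU ?mul0r// => /divg_unit E.
by rewrite E ?eqxx in yx'.
Qed.

Hypothesis cU : c @^-1` [set 1%g] = units Gr.

(** The element x y^-1 has degree 1, so it is a unit. *)
Lemma homogeneous_src_inj x y : c x = c y -> s x = s y -> x = y.
Proof.
move=> cxy sxy; apply: divg_unit (sxy) _; rewrite -cU /= (cocycle_div cP.1)// cxy.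
exact: mulgV.
Qed.

(** On a function supported in c^-1(t), where s is injective, this is the
    transport to the unit space along s; written as a sum over a fibre, it
    needs no choice of a section and is continuous as a fibre sum. *)
Definition src_push w : G -> Cplx R := fun x =>
  if c x == 1%g then \sum_(y \in [set y | s y = s x]) 1 * w y else 0.

Lemma src_push_homogeneous w t z : (forall x, w x != 0 -> c x = t) -> c z = t ->
  src_push w (s z) = w z.
Proof.
move=> wt zt; have csz : c (s z) = 1%g.
  have : (c @^-1` [set 1%g]) (s z) by rewrite cU; exists z.
  by [].
rewrite /src_push csz eqxx (fsum_seq (t := [:: z])) ?big_seq1 ?mul1r//.
  by move=> y; rewrite inE => /eqP->; rewrite /= src_src.
move=> y /= yz; rewrite inE => yz'; rewrite mul1r; apply/eqP; apply: contrapT.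
move=> /negP/wt yt; case/eqP: yz'; apply: homogeneous_src_inj; first by rewrite yt.
by rewrite yz src_src.
Qed.

Lemma src_push_neq0 w x : src_push w x != 0 ->
  units Gr x /\ exists2 y, w y != 0 & s y = x.
Proof.
rewrite /src_push; case: (c x =P 1%g) => [cx|_]; last by rewrite eqxx.
have Ux : units Gr x by rewrite -cU.
move=> /negP n0; split=> //; apply: contrapT => nw; apply: n0.
rewrite fsbig1// => y /= yx; rewrite mul1r; apply/eqP; apply: contrapT => /negP wy.
by apply: nw; exists y => //; rewrite yx (unit_srcP _ _).1.
Qed.

Lemma src_push_continuous w : continuous w -> compact (supp w) -> continuous (src_push w).
Proof.
move=> wc wk x; apply: (continuous_at_eq_near (g := fun y => if c x == 1%g
    then \sum_(z \in [set z | s z = s y]) 1 * w z else 0)).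
  by apply: filterS (cocycle_near cP x) => y cy; rewrite /src_push cy.
case: (c x == 1%g); last exact: cst_continuous.
apply: (@fibre_sum_continuous _ _ etG _ (fun _ _ => 1)) => // h x0 _ _.
exact: cst_continuous.
Qed.

Lemma src_push_compact w : compact (supp w) -> compact (s @` supp w).
Proof.
by apply: continuous_compact; apply: continuous_subspaceT; exact: src_continuous.
Qed.

Lemma C0_src_push w : continuous w -> compact (supp w) -> C0_units Gr (src_push w).
Proof.
move=> wc wk; have pc := src_push_continuous wc wk; split=> //.
  move=> x nx; apply/eqP; apply: contrapT => /negP/src_push_neq0[].
  by move=> /nx.
move=> e e0; apply: subclosed_compact (src_push_compact wk) _.
  rewrite -[X in closed X]setCK; apply: open_closedC; rewrite openE => x /= /negP.
  rewrite normC_abs2 lecR -ltNge => hx.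
  have hx' : `|src_push w x| < e%:C by rewrite normC_abs2 ltcR.
  have near_x : \forall y \near x, `|src_push w y| < e%:C.
    exact: cvgr_norm_lt _ (pc x) _ hx'.
  suff : \forall y \near x, ~ e%:C <= `|src_push w y| by [].
  apply: (filterS _ near_x) => y hy; apply/negP; move: hy.
  by rewrite normC_abs2 ltcR lecR -ltNge.
move=> x /= ex; have [|_ [y wy yx]] := @src_push_neq0 w x.
  apply/eqP => x0; move: ex; rewrite x0 normr0 lecR; apply/negP; rewrite -ltNge//.
by exists y => //; exact: suppP.
Qed.

Lemma src_push_multiplier w : continuous w -> compact (supp w) ->
  exists2 b : l2op R G, C0_units_op R Gr b &
    forall xi x, b xi x = src_push w (r x) * xi x.
Proof.
move=> wc wk; have wC := C0_src_push wc wk; have [pc pU _] := wC.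
have [|m hm] := @compact_bounded_by _ R _ (fun x => abs2 (src_push w x))
    (src_push_compact wk).
  move=> x _; have E y : abs2 (src_push w y) =
      complex.Re (src_push w y * (src_push w y)^*).
    by case: (src_push w y) => p q; rewrite /abs2 /=; ring.
  rewrite (_ : (fun x => _) = fun y => complex.Re (src_push w y * (src_push w y)^* : Cplx R)).
    by apply: continuous_Re_at; apply: cvgM; [exact: pc|apply: continuous_conj_at; exact: pc].
  exact/funext.
have hm' x : abs2 (src_push w x) <= Num.max m 0.
  rewrite le_max; have [->|/src_push_neq0[_ [y wy yx]]] := eqVneq (src_push w x) 0.
    by rewrite abs2_0 lexx orbT.
  by rewrite hm//; exists y => //; exact: suppP.
by have [b hb bE] := unit_multiplier pU hm'; exists b => //; exists (src_push w).
Qed.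

(** Since c^-1(t) is a bisection, a function supported in it is a sum of
    products (a_x) (w_x o s) where the a_x belong to M, vanish off c^-1(t)
    and have no common zero on the support K of f: take
    w_x = f (a_x)^* / q for q the sum of the |a_x|^2, which is positive on K. *)
Lemma bisection_conv_mem M t f F : diagonal_bimodule Gr M ->
  Cr R Gr F -> Cc setT f -> is_conv Gr f F ->
  (forall x, supp f x -> c x = t /\ exists b, [/\ M b,
     forall y, jmap Gr b y != 0 -> c y = t & jmap Gr b x != 0]) -> M F.
Proof.
move=> [[sM Mcl] MC MB] CF [fc fk _] fF fM.
have /choice[a aP] x : exists b, [/\ M b, forall y, jmap Gr b y != 0 -> c y = t &
    supp f x -> jmap Gr b x != 0].
  have [/fM[_ [b [Mb bt bx]]]|nx] := pselect (supp f x); first by exists b.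
  exists 0; split=> [|y|/nx//]; first by case: sM.
  by rewrite /jmap opzeroE l2zeroE eqxx.
pose j x := jmap Gr (a x).
have jc x : continuous (j x) by have [/MC] := aP x; move=> /jmap_continuous.
have [|l [_ lP]] := compact_subcover (O := fun x => [set y | j x y != 0]) fk.
  move=> x Kx; split; last by have [_ _] := aP x; exact.
  rewrite openE => y /= jy; rewrite /interior.
  exact: cvgr_neq0 _ (jc x y) jy.
pose q y : Cplx R := \sum_(x <- l) j x y * (j x y)^*.
have qE y : q y = (\sum_(x <- l) abs2 (j x y))%:C.
  rewrite /q rmorph_sum/=; apply: eq_bigr => x _; case: (j x y) => u v.
  by apply/eqP; rewrite eq_complex /abs2 /=; apply/andP; split; apply/eqP; ring.
have q0 y : supp f y -> q y != 0.
  move=> /lP[x xl jx]; rewrite qE; apply/eqP => -[] /eqP.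
  rewrite psumr_eq0 => [/allP/(_ _ xl)/= /eqP/abs2_eq0 E|z _]; last exact: abs2_ge0.
  by move: jx => /=; rewrite E eqxx.
have qc : continuous q.
  move=> y; apply: continuous_at_sum => x; apply: cvgM; first exact: jc.
  by apply: continuous_conj_at; exact: jc.
pose w x y : Cplx R := f y * (j x y)^* / q y.
have wf x y : w x y != 0 -> f y != 0.
  by apply: contraNneq => f0; rewrite /w f0 !mul0r.
have wsupp x : supp (w x) `<=` supp f by apply: closure_subset => y /= /wf.
have wk x : compact (supp (w x)).
  by apply: subclosed_compact fk (wsupp x); exact: closed_closure.
have wc x : continuous (w x).
  move=> y; have [Ky|nKy] := pselect (supp f y).
    apply: cvgM; last by apply: cvgV; [exact: q0|exact: qc].
    by apply: cvgM; [exact: fc|apply: continuous_conj_at; exact: jc].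
  apply: (continuous_at_eq_near (g := fun=> 0)); last exact: cst_continuous.
  have nK : nbhs y (~` supp f).
    by apply: open_nbhs_nbhs; split=> //; apply: closed_openC; exact: closed_closure.
  by apply: filterS nK => z /supp_notin f0; rewrite /w f0 !mul0r.
have /choice[b bP] x : exists b, C0_units_op R Gr b /\
    forall xi z, b xi z = src_push (w x) (r z) * xi z.
  by have [b bC bE] := src_push_multiplier (wc x) (wk x); exists b.
have -> : F = \sum_(x <- l) (a x \o b x).
  apply: (@Cr_jmap_inj _ _ Gr) => //.
    apply: MC; apply: subspace_sum => // x; have [Ma _ _] := aP x.
    by have [] := MB _ _ Ma (bP x).1.
  rewrite (matrix_jmap (conv_matrix fF)); apply/funext => z.
  have abE x : (a x \o b x) (l2delta R (s z)) z = src_push (w x) (s z) * j x z.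
    have [/MC/Cr_bounded/bounded_op_linear al _ _] := aP x.
    have -> : (a x \o b x) (l2delta R (s z)) = a x (b x (l2delta R (s z))) by [].
    rewrite (_ : b x _ = src_push (w x) (s z) *: l2delta R (s z)).
      by rewrite (oplinZ al) l2scaleE.
    apply: l2_eq => y; rewrite (bP x).2 l2scaleE.
    have [->|ysz] := eqVneq y (s z); first by rewrite rng_src.
    have -> : l2delta R (s z) y = 0 by rewrite /= (negbTE ysz).
    by rewrite !mulr0.
  have -> v : jmap Gr (\sum_(x <- v) (a x \o b x)) z =
      \sum_(x <- v) src_push (w x) (s z) * j x z.
    rewrite /jmap; elim: v => [|x v IH]; first by rewrite !big_nil.
    by rewrite !big_cons opaddE l2addE abE IH.
  have [zt|nzt] := pselect (c z = t); last first.
    rewrite big1 => [|x _]; last first.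
      have [_ jt _] := aP x; rewrite (_ : j x z = 0) ?mulr0//.
      by apply/eqP; apply: contrapT => /negP/jt.
    by apply: supp_notin => /fM[].
  have wz x : src_push (w x) (s z) * j x z = f z / q z * (j x z * (j x z)^*).
    rewrite (@src_push_homogeneous _ t)//; last by move=> y /wf/suppP/fM[].
    by rewrite /w [f z * _ / _]mulrAC -[LHS]mulrA; congr (_ * _); exact: mulrC.
  rewrite (eq_bigr _ (fun x _ => wz x)) -mulr_sumr -/(q z).
  have [Kz|nKz] := pselect (supp f z); last by rewrite supp_notin// !mul0r.
  by rewrite divfK// q0.
apply: subspace_sum => // x; have [Ma _ _] := aP x.
by have [] := MB _ _ Ma (bP x).1.
Qed.

End bisections.

(** * The theorem *)

Theorem proposition4p10 (R : realType) (G : topologicalType) (Gr : groupoid G)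
    (Gamma : groupType) (c : G -> Gamma)
    (delta : l2op R G -> l2op R (G * Gamma)%type) (M : set (l2op R G)) :
  etale_groupoid Gr ->
  FCAP R Gr ->
  countable [set: Gamma] -> infinite_set [set: Gamma] ->
  (exists x y : Gamma, (x * y <> y * x)%g) ->
  cocycle Gr c ->
  induced_coaction Gr c delta ->
  diagonal_bimodule Gr M ->
  (coaction_invariant delta M ->
     (spectral Gr M <->
      forall t : Gamma, spectral Gr (M `&` spectral_subspace Gr delta t)))
  /\
  ((spectral Gr M -> coaction_invariant delta M) /\
   (c @^-1` [set 1%g] = units Gr ->
      (spectral Gr M <-> coaction_invariant delta M))).
Proof.
move=> etG fcap _ _ _ cP deltaP MB; have [Mcs MC _] := MB.
have inv := spectral_invariant etG cP deltaP fcap Mcs.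
split=> [Minv|]; last split=> // cU.
  split=> [Msp t|]; first exact: (spectral_component etG cP deltaP fcap).
  exact: (invariant_spectral_of_components etG cP deltaP fcap Mcs MC Minv).
split=> // Minv; apply: (spectral_of_homogeneous etG cP fcap Mcs MC) => t F CF [f fP fF].
apply: (bisection_conv_mem etG cP cU (t := t) MB CF (Cc_sub (@subsetT _ _) fP) fF) => x fx.
have [_ _ /(_ _ fx)[Mx cx]] := fP; split=> //.
have [b [Mb bt bx]] := invariant_component etG cP deltaP fcap Mcs MC Minv Mx cx.
by exists b; split=> // y; exact: (spectral_subspace_homogeneous etG cP deltaP bt).
Qed.
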